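(* Let $n>1$. The nil-potency index of the Jacobson radical $\mathsf{Rad}\,\mathcal{P}_n$ is $\frac{n-1}{2}$ if $n$ is odd, and $\frac n2$ if $n$ is even.
   Context: $K$ is a field of characteristic $0$. Permutations act on the right ($i\pi$ is the image of $i$) and products in $S_n$ are read from left to right. For $\pi\in S_n$, $\mathrm{Peak}(\pi)=\{2\le i\le n-1\mid (i-1)\pi<i\pi>(i+1)\pi\}$. $\mathcal{P}_n$ is the $K$-linear span in $KS_n$ of the elements $\sum_{\mathrm{Peak}(\pi)=P}\pi$, $P\subseteq\{2,\ldots,n-1\}$; it is a subalgebra of $KS_n$ (in general without identity). $\mathsf{Rad}\,\mathcal{P}_n$ is the intersection of all maximal $\mathcal{P}_n$-submodules of the left module $\mathcal{P}_n$ (with $\mathcal{P}_n$ acting by left multiplication). The nil-potency index of a nilpotent ideal $R$ is the smallest $m\ge1$ with $R^m=0$ (so it is $1$ if $R=0$). *)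

(* Defs.v *)
From HB Require Import structures.
From mathcomp Require Import all_boot all_order all_algebra all_fingroup all_field.
From mathcomp Require Import boolp.

Set Implicit Arguments.
Unset Strict Implicit.
Unset Printing Implicit Defensive.

Import GRing.Theory.

Local Open Scope ring_scope.

(* The alias hides the pointwise product that {ffun gT -> K} carries, so that
   the type can be given the convolution product. *)
Definition group_algebra (K : fieldType) (gT : finGroupType) : Type :=
  {ffun gT -> K}.

Section GroupAlgebra.
Variables (K : fieldType) (gT : finGroupType).
Local Notation KG := (group_algebra K gT).
Implicit Types u v w : KG.

HB.instance Definition _ := Vector.copy KG {ffun gT -> K^o}.

Definition ga_one : KG := [ffun g => (g == 1%g)%:R].
Definition ga_mul u v : KG := [ffun g => \sum_h u h * v (h^-1 * g)%g].

Fact ga_mulA : associative ga_mul.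
Proof.
move=> u v w; apply/ffunP=> g; rewrite !ffunE.
under eq_bigr do rewrite ffunE big_distrr /=.
under [RHS]eq_bigr do rewrite ffunE big_distrl /=.
rewrite [RHS]exchange_big /=; apply: eq_bigr => h _.
rewrite [RHS](reindex_inj (mulgI h)) /=; apply: eq_bigr => k _.
by rewrite mulrA mulKg invMg mulgA.
Qed.

Fact ga_mul1 : left_id ga_one ga_mul.
Proof.
move=> u; apply/ffunP=> g; rewrite ffunE (bigD1 1%g) //= ffunE eqxx mul1r.
rewrite invg1 mul1g big1 ?addr0 // => h /negPf h1.
by rewrite ffunE h1 mul0r.
Qed.

Fact ga_mulr1 : right_id ga_one ga_mul.
Proof.
move=> u; apply/ffunP=> g; rewrite ffunE (bigD1 g) //= ffunE mulVg eqxx mulr1.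
rewrite big1 ?addr0 // => h /negPf hg.
by rewrite ffunE -eq_mulVg1 hg mulr0.
Qed.

Fact ga_mulDl : left_distributive ga_mul +%R.
Proof.
move=> u v w; apply/ffunP=> g; rewrite !ffunE -big_split /=.
by apply: eq_bigr => h _; rewrite ffunE mulrDl.
Qed.

Fact ga_mulDr : right_distributive ga_mul +%R.
Proof.
move=> u v w; apply/ffunP=> g; rewrite !ffunE -big_split /=.
by apply: eq_bigr => h _; rewrite ffunE mulrDr.
Qed.

Fact ga_one_neq0 : ga_one != 0.
Proof. by apply/eqP=> /ffunP/(_ 1%g)/eqP; rewrite !ffunE eqxx oner_eq0. Qed.

HB.instance Definition _ := GRing.Zmodule_isNzRing.Build KG
  ga_mulA ga_mul1 ga_mulr1 ga_mulDl ga_mulDr ga_one_neq0.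

Fact ga_scaleAl (a : K) u v : a *: (u * v) = (a *: u) * v.
Proof.
apply/ffunP=> g; rewrite !ffunE scaler_sumr.
by apply: eq_bigr => h _; rewrite ffunE; apply: mulrA.
Qed.

HB.instance Definition _ := GRing.Lmodule_isLalgebra.Build K KG ga_scaleAl.

Fact ga_scaleAr (a : K) u v : a *: (u * v) = u * (a *: v).
Proof.
apply/ffunP=> g; rewrite !ffunE scaler_sumr.
by apply: eq_bigr => h _; rewrite ffunE; apply: mulrCA.
Qed.

HB.instance Definition _ := GRing.Lalgebra_isAlgebra.Build K KG ga_scaleAr.
HB.instance Definition _ := Algebra_isFalgebra.Build K KG.

Definition ga_delta (g : gT) : KG := [ffun h => (h == g)%:R].

Lemma ga_deltaM (g h : gT) : ga_delta g * ga_delta h = ga_delta (g * h)%g.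
Proof.
apply/ffunP=> x; rewrite !ffunE (bigD1 g) //= !ffunE eqxx mul1r.
rewrite big1 ?addr0 => [|y /negPf yg]; last by rewrite ffunE yg mul0r.
by rewrite -(inj_eq (mulgI g)) mulKVg.
Qed.

End GroupAlgebra.

Section Radical.
Variables (K : fieldType) (L : falgType K).
Implicit Types A U V M R : {vspace L}.

(* Submodules over an algebra A that may lack an identity are required to be
   K-subspaces; A * U is the span of the products. *)
Definition submodule A M U : bool := ((U <= M) && (A * U <= U))%VS.

Definition maximal_submodule A M U : Prop :=
  [/\ submodule A M U, U != M
    & forall V, submodule A M V -> (U <= V)%VS -> V = U \/ V = M].

Lemma radical_exists A :
  exists R, forall x : L,
    x \in R <-> x \in A /\ forall U, maximal_submodule A A U -> x \in U.
Proof.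
pose S R := forall x : L,
  x \in R -> x \in A /\ forall U, maximal_submodule A A U -> x \in U.
have S0 : S 0%VS.
  by move=> x; rewrite memv0 => /eqP->; split=> [|U _]; apply: mem0v.
have exS : exists d, `[< exists2 R, S R & \dim R = d >].
  by exists 0; apply/asboolP; exists 0%VS; rewrite ?dimv0.
have leS d : `[< exists2 R, S R & \dim R = d >] -> (d <= \dim A)%N.
  move=> /asboolP[R SR <-]; apply: dimvS; apply/subvP=> x /SR.
  by case.
case: (ex_maxnP exS leS) => d /asboolP[R SR dR] maxd.
exists R => x; split=> [/SR // | [xA xU]].
have SRx : S (R + <[x]>)%VS.
  move=> _ /memv_addP[r /SR[rA rU] [_ /vlineP[k ->] ->]].
  split=> [|U maxU]; first by rewrite rpredD ?rpredZ.
  by rewrite rpredD ?rpredZ ?rU ?xU.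
have le_d : (\dim (R + <[x]>) <= d)%N by apply: maxd; apply/asboolP; exists (R + <[x]>)%VS.
have /eqP -> : R == (R + <[x]>)%VS by rewrite eqEdim addvSl dR.
by apply: (subvP (addvSr _ _)); apply: memv_line.
Qed.

(* The intersection of all maximal A-submodules of the left module A. *)
Definition radical A : {vspace L} := projT1 (cid (radical_exists A)).

Lemma radicalP A (x : L) :
  x \in radical A <-> x \in A /\ forall U, maximal_submodule A A U -> x \in U.
Proof. by rewrite /radical; case: cid. Qed.

Definition nilpotency_index R (m : nat) : Prop :=
  [/\ (0 < m)%N, (R ^+ m)%VS = 0%VS
    & forall k, (0 < k)%N -> (R ^+ k)%VS = 0%VS -> (m <= k)%N].

End Radical.

Section PeakAlgebra.
Variables (K : fieldType) (n : nat).

(* Positions and values are shifted by one: position i : 'I_n stands for i + 1.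
   The product of 'S_n satisfies (s * t) i = t (s i), i.e. it is read from left
   to right. *)
Definition Peak (s : 'S_n) : {set 'I_n} :=
  [set i : 'I_n | [exists j : 'I_n, exists k : 'I_n,
     [&& (i == j.+1 :> nat), (k == i.+1 :> nat), (s j < s i)%N & (s k < s i)%N]]].

Definition inner_positions : {set 'I_n} := [set i : 'I_n | (0 < i < n.-1)%N].

Definition peak_sum (P : {set 'I_n}) : group_algebra K 'S_n :=
  \sum_(s : 'S_n | Peak s == P) ga_delta K s.

Definition peak_algebra : {vspace group_algebra K 'S_n} :=
  <<[seq peak_sum P | P : {set 'I_n} in powerset inner_positions]>>%VS.

End PeakAlgebra.

(* Main.v *)
(** For a composition of [N.+1] with set of cuts [C], let [Theta C] be, up to the
    factor [2 ^ #|C|.+1], the sum of the permutations without peaks inside the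
    blocks of [C]; these elements span the peak algebra [A].

    Upper bound. [Theta C] is a sum over sorting permutations for signed labels,
    and sorting successively by two labels is sorting by the pair of them; so
    [Theta C * x] is a multiple of [Theta C] plus terms with more cuts.  Let
    [Fil k] be the span of the [Theta C] with [#|C| >= k].  An element [x] of the
    radical acts from the right without nonzero eigenvalue, since [a + a x] runs
    through [A] with [a]; hence it maps [Fil k] to [Fil k.+1].  Inverting all
    signs shows that [Fil k = Fil k.+1] when [N + k] is odd, so in fact each
    factor gains two steps.

    Lower bound. Commutators raise the filtration, hence generate nilpotent
    left ideals, and [(a b - b a) a] lies in the radical.  Let the group algebra act on
    words in two letters one of which occurs once, i.e. on polynomials of degree at
    most [N].  In the basis [('X - 1) ^+ j] the elements of [A] are triangular and
    kill the odd basis vectors, and for [a] with one block and [b] with two blocks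
    of weights 1 and 2 the coefficient of [(a b - b a) a] from [t] to [t + 2] is
    a nonzero multiple of [2 ^ t.+1 - 2].  This vanishes only at [t = 0], so starting
    from [t = 2] the required power is nonzero. *)

From HB Require Import structures.
Require Import Defs.
From mathcomp Require Import all_boot all_order all_algebra all_fingroup all_field.
From mathcomp Require Import boolp zify ring.

Set Implicit Arguments.
Unset Strict Implicit.
Unset Printing Implicit Defensive.

Import GRing.Theory.

(** * The radical of a finite-dimensional algebra that may lack an identity *)

Section RadicalTheory.
Local Open Scope ring_scope.
Variables (K : fieldType) (L : falgType K).
Implicit Types A U V M R F : {vspace L}.

(** By finite dimension, a proper submodule of largest dimension among those containing [U] is
    maximal. *)
Lemma submodule_sub_maximal A M U : submodule A M U -> U != M ->
  exists2 V, maximal_submodule A M V & (U <= V)%VS.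
Proof.
move=> subU UM.
pose P d := `[< exists V, [/\ submodule A M V, V != M, (U <= V)%VS & \dim V = d] >].
have exP : exists d, P d by exists (\dim U); apply/asboolP; exists U.
have leP d : P d -> (d <= \dim M)%N.
  by move=> /asboolP[V [/andP[VM _] _ _ <-]]; apply: dimvS.
case: (ex_maxnP exP leP) => d /asboolP[V [subV VM UV dV]] maxd.
exists V => //; split=> // W subW VW.
have [->|WM] := eqVneq W M; [by right | left].
apply/esym/eqP; rewrite eqEdim VW dV; apply: maxd; apply/asboolP.
by exists W; split=> //; apply: subv_trans VW.
Qed.

Variable A : {vspace L}.
Hypothesis mulA : (A * A <= A)%VS.
Local Notation R := (radical A).

Let memM x y : x \in A -> y \in A -> x * y \in A.
Proof. by move=> xA yA; apply: (subvP mulA); apply: memv_mul. Qed.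

Lemma radical_sub x : x \in R -> x \in A.
Proof. by case/radicalP. Qed.

Lemma radical_mull a x : a \in A -> x \in R -> a * x \in R.
Proof.
move=> aA /radicalP[xA xU]; apply/radicalP; split=> [|U maxU]; first exact: memM.
case: (maxU) => /andP[_ /subvP AU] _ _.
by apply: AU; apply: memv_mul => //; apply: xU.
Qed.

(** The image of [b |-> b + b x] is a submodule of [A]. If it were proper, it would lie in a maximal
    submodule [V]; as [x] is in [V], so is [b x], hence every [b]. *)
Lemma radical_qregular x a : x \in R -> a \in A ->
  exists2 b, b \in A & a = b + b * x.
Proof.
move=> xR aA; have [xA xU] := (radicalP A x).1 xR.
pose f : 'End(L) := (\1 + amulr x)%VF.
have fE b : f b = b + b * x by rewrite add_lfunE id_lfunE lfunE.
suff fA : (f @: A)%VS = A.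
  by move: aA; rewrite -{1}fA => /memv_imgP[b bA ->]; exists b.
apply/eqP; apply: contraT => nA.
have sub : submodule A A (f @: A)%VS.
  apply/andP; split; apply/subvP.
    by move=> _ /memv_imgP[b bA ->]; rewrite fE rpredD // memM.
  apply/subvP/prodvP => u _ uA /memv_imgP[b bA ->].
  by apply/memv_imgP; exists (u * b); rewrite ?memM // !fE mulrDr mulrA.
have [V maxV /subvP fV] := submodule_sub_maximal sub nA.
have [/andP[/subvP VA /subvP AV] VnA _] := maxV.
case/negP: VnA; rewrite eqEsubv; apply/andP; split; apply/subvP=> // b bA.
have : f b \in V by apply: fV; apply: memv_img.
by rewrite fE rpredDr // AV // memv_mul // xU.
Qed.

(** By surjectivity and dimension, [b |-> b + b x] is bijective on [A]. It maps [F] into [F], hence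
    onto [F], so nothing of [A] outside [F] is sent into [F]. *)
Lemma radical_qinj x F : x \in R -> (F <= A)%VS -> (F * A <= F)%VS ->
  forall a, a \in A -> a + a * x \in F -> a \in F.
Proof.
move=> xR /subvP FA /subvP FAF a aA aF; have xA := radical_sub xR.
pose f : 'End(L) := (\1 + amulr x)%VF.
have fE b : f b = b + b * x by rewrite add_lfunE id_lfunE lfunE.
have fA : (f @: A)%VS = A.
  apply/eqP; rewrite eqEsubv; apply/andP; split; apply/subvP=> b.
    by move=> /memv_imgP[c cA ->]; rewrite fE rpredD // memM.
  move=> bA; have [c cA ->] := radical_qregular xR bA.
  by rewrite -fE memv_img.
have kerA : (A :&: lker f)%VS = 0%VS.
  by apply/eqP; rewrite -dimv_eq0; have := limg_ker_dim f A;
    rewrite fA -{2}[\dim A]add0n => /addIn ->.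
have fF : (f @: F)%VS = F.
  apply/eqP; rewrite eqEdim; apply/andP; split.
    apply/subvP=> b /memv_imgP[c cF ->]; rewrite fE rpredD //.
    by apply: FAF; apply: memv_mul.
  rewrite -(limg_ker_dim f F) -[X in (_ <= X)%N]add0n leq_add2r leqn0 dimv_eq0.
  rewrite -subv0 -kerA subv_cap capvSr andbT.
  by apply: subv_trans (capvSl _ _) _; apply/subvP.
have /memv_imgP[b bF eab] : f a \in (f @: F)%VS by rewrite fF fE.
suff: a - b == 0 by rewrite subr_eq0 => /eqP ->.
rewrite -memv0 -kerA memv_cap memv_ker linearB /= eab subrr eqxx andbT.
by rewrite rpredB // FA.
Qed.

(* Nakayama: modulo a maximal submodule missing [z * c], one could write
   [c = (l z + a z) c]. *)
Lemma nilpotent_mul_radical z c : z \in A -> c \in A ->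
    (forall l a, a \in A -> exists k, (l *: z + a * z) ^+ k = 0) ->
  z * c \in R.
Proof.
move=> zA cA nil; apply/radicalP; split=> [|U maxU]; first exact: memM.
have [/andP[/subvP UA /subvP AU] _ Umax] := maxU.
have AUm a u : a \in A -> u \in U -> a * u \in U by move=> ? ?; apply: AU; apply: memv_mul.
(* The line through [z * c] is added separately, because without an identity [A z c] need not
   contain it. *)
pose V := (U + (<[z * c]> + amulr (z * c) @: A))%VS.
have UV : (U <= V)%VS by apply: addvSl.
have sub : submodule A A V.
  apply/andP; split.
    rewrite !subv_add; apply/and3P; split; first exact/subvP.
      by rewrite -memvE !memM.
    by apply/subvP=> _ /memv_imgP[a aA ->]; rewrite lfunE /= !memM.
  apply/prodvP=> a _ aA /memv_addP[u uU [_ /memv_addP[_ /vlineP[l ->] [_ /memv_imgP[b bA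
    ->] ->]] ->]].
  rewrite mulrDr memv_add ?AUm //; apply: (subvP (addvSr _ _)).
  apply/memv_imgP; exists (l *: a + a * b); first by rewrite rpredD ?rpredZ ?memM.
  by rewrite !lfunE /= mulrDr mulrDl -scalerAr -scalerAl !mulrA.
have [VU|VA] := Umax V sub UV.
  by rewrite -VU; apply: (subvP (addvSr _ _)); apply: (subvP (addvSl _ _)); apply: memv_line.
have : c \in V by rewrite VA.
move=> /memv_addP[u uU [_ /memv_addP[_ /vlineP[l ->] [_ /memv_imgP[b bA ->] ->]] ec]].
rewrite lfunE /= in ec; pose w := l *: z + b * z.
have wA : w \in A by rewrite rpredD ?rpredZ ?memM.
have {}ec : c = u + w * c by rewrite {1}ec mulrDl -scalerAl mulrA.
(* Iterating [c = u + w c] gives [c = w ^ k c] modulo [U]. *)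
have ck k : exists2 v, v \in U & c = v + w ^+ k * c.
  elim: k => [|k [v vU ev]]; first by exists 0; rewrite ?mem0v // expr0 mul1r add0r.
  exists (u + w * v); first by rewrite rpredD ?AUm.
  by rewrite -addrA exprS -mulrA -mulrDr -ev.
have [k wk] := nil l b bA; have [v vU ev] := ck k.
by rewrite AUm // ev -/w wk mul0r addr0.
Qed.

End RadicalTheory.

(** * Permutations that sort letters by signed labels *)

Section SignedSort.
Variable N : nat.
Local Notation I := 'I_N.+1.
Implicit Types (k : I -> nat) (s : 'S_N.+1).

Definition lo (i : 'I_N) : I := widen_ord (leqnSn N) i.
Definition hi (i : 'I_N) : I := lift ord0 i.

Lemma val_lo i : lo i = i :> nat. Proof. by []. Qed.
Lemma val_hi i : hi i = i.+1 :> nat. Proof. by []. Qed.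

(* Letters are sorted by their labels; letters with the same label keep their
   order if the label is odd and are reversed if it is even. *)
Definition prec k (a b : I) : bool :=
  (k a < k b) || (k a == k b) && (if odd (k a) then a < b else b < a).

Lemma prec_irr k a : prec k a a = false.
Proof. by rewrite /prec !ltnn eqxx; case: odd. Qed.

Lemma prec_trans k : transitive (prec k).
Proof.
move=> b a c; rewrite /prec => /orP[ab|/andP[/eqP-> ab]].
  by case/orP=> [bc|/andP[/eqP<- _]]; rewrite ?ab ?(ltn_trans ab bc).
case/orP=> [->//|/andP[/eqP<-]]; rewrite ltnn eqxx /=.
by case: odd ab; lia.
Qed.

Lemma prec_total k a b : a != b -> prec k a b || prec k b a.
Proof.
rewrite /prec -val_eqE /= neq_ltn; case: (ltngtP (k a) (k b)) => //= ->.
by case: odd; rewrite // orbC.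
Qed.

Lemma card_ord_below (c : I) : #|[set b : I | b < c]| = c.
Proof.
have le : c <= N.+1 by rewrite ltnW.
rewrite -[RHS]card_ord -cardsT -(@card_imset _ _ (widen_ord le)).
  apply: eq_card => b; rewrite !inE; apply/idP/imsetP => [bc | [d _ ->]];
    last exact: (ltn_ord d).
  by exists (Ordinal bc) => //; apply: val_inj.
by move=> x y /(congr1 val) /= /val_inj.
Qed.

Definition rank k a : nat := #|[set b | prec k b a]|.

Lemma rank_lt k a : rank k a < N.+1.
Proof.
rewrite -[X in _ < X]card_ord -cardsT; apply: proper_card.
by rewrite properT; apply/eqP => /setP/(_ a); rewrite !inE prec_irr.
Qed.

Lemma rank_mono k a b : (rank k a < rank k b) = prec k a b.
Proof.
have mono c d : prec k c d -> rank k c < rank k d.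
  move=> cd; apply: proper_card; apply/properP; split.
    by apply/subsetP => e; rewrite !inE => /prec_trans; apply.
  by exists c; rewrite !inE ?prec_irr.
apply/idP/idP; last exact: mono.
case: (eqVneq a b) => [->|/(prec_total k)/orP[//|/mono]]; rewrite ?ltnn //.
by move/ltnW; rewrite leqNgt => /negPf ->.
Qed.

Definition rankI k a : I := Ordinal (rank_lt k a).

Lemma rankI_inj k : injective (rankI k).
Proof.
move=> a b /(congr1 val) /= ab; apply/eqP; apply: contraT => /(prec_total k).
by rewrite -!rank_mono ab ltnn.
Qed.

Definition rho k : 'S_N.+1 := perm (@rankI_inj k).

Lemma val_rho k a : rho k a = rank k a :> nat.
Proof. by rewrite permE. Qed.

Lemma rho_lt k a b : (rho k a < rho k b) = prec k a b.
Proof. by rewrite !permE rank_mono. Qed.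

(** The letters before [a] are exactly those that [s] sends below [s a], so [s a] is the rank of
    [a]. *)
Lemma rho_unique k s : (forall a b, prec k a b -> s a < s b) -> rho k = s.
Proof.
move=> mono; apply/permP => a; apply/val_inj; rewrite permE /= /rank.
have -> : [set b | prec k b a] = s @^-1: [set b : I | b < s a].
  apply/setP => b; rewrite !inE; apply/idP/idP; first exact: mono.
  have [-> | /(prec_total k)/orP[// | /mono]] := eqVneq b a; first by rewrite ltnn.
  by move/ltnW; rewrite leqNgt => /negPf ->.
rewrite card_preimset; last exact: perm_inj.
exact: card_ord_below.
Qed.

Lemma ltn_adjacent (P : rel I) : transitive P ->
  (forall i, P (lo i) (hi i)) -> forall a b : I, a < b -> P a b.
Proof.
move=> trP adj a b; have [d] := ubnP (b - a); elim: d b => // d IH b bd ab.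
have bN : b.-1 < N by have := ltn_ord b; lia.
have eb : hi (Ordinal bN) = b by apply: val_inj => /=; rewrite /bump; lia.
have := adj (Ordinal bN); rewrite eb => Pb.
have [ea | na] := eqVneq (lo (Ordinal bN)) a; first by rewrite -ea.
by apply: trP Pb; apply: IH; move: na; rewrite -val_eqE /=; lia.
Qed.

(** By transitivity of [prec], a sequence of letters is sorted as soon as its neighbours are. *)
Lemma rho_inv_eq k s :
  ((rho k)^-1%g == s) = [forall i, prec k (s (lo i)) (s (hi i))].
Proof.
apply/eqP/forallP => [<- i | adj].
  by rewrite -rho_lt !permKV /= /bump.
apply/eqP; rewrite eqg_invLR; apply/eqP/rho_unique => a b ab.
rewrite ltnNge; apply/negP; rewrite leq_eqVlt => /orP[/eqP/val_inj/perm_inj e|].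
  by move: ab; rewrite e prec_irr.
have tr : transitive (fun a b => prec k (s a) (s b)) by move=> y x z; apply: prec_trans.
move/(ltn_adjacent tr adj); rewrite !permKV => ba.
by have := prec_trans ab ba; rewrite prec_irr.
Qed.

Lemma rho_mul k1 k2 k3 :
    (forall a b, prec k3 a b = prec k1 (rho k2 a) (rho k2 b)) ->
  ((rho k1)^-1 * (rho k2)^-1 = (rho k3)^-1)%g.
Proof.
move=> e; rewrite -invMg; congr (_^-1)%g; apply/esym/rho_unique => a b.
by rewrite e !permM rho_lt.
Qed.
End SignedSort.

(** * Weighted sums of sorting permutations and the elements [Theta C] *)

Section Theta.
Local Open Scope ring_scope.
Variables (K : fieldType) (N : nat).
Local Notation I := 'I_N.+1.
Local Notation KS := (group_algebra K 'S_N.+1).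
Implicit Types (s : 'S_N.+1) (C E T : {set 'I_N}) (e : {ffun I -> bool}).

Definition desc s (i : 'I_N) : bool := (s (hi i) < s (lo i))%N.

(* A sequence of signs [e] is compatible with [s] at [i] if, within a block,
   [s] decreases along the negative (false) entries, which come first, and
   increases along the positive ones. *)
Definition compat s e (i : 'I_N) : bool :=
  if desc s i then ~~ e (lo i) else e (hi i).

(* [i] in [C] is a cut between positions [i] and [i.+1] of a composition. *)
Definition Theta C : KS :=
  [ffun s => \sum_e \prod_(i | i \notin C) (compat s e i)%:R].

Lemma prod_bool (T : finType) (P Q : pred T) :
  \prod_(i | P i) (Q i)%:R = [forall (i | P i), Q i]%:R :> K.
Proof.
have [/forall_inP PQ | ] := boolP [forall (i | P i), Q i].
  by rewrite big1 // => i Pi; rewrite PQ.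
rewrite negb_forall_in => /exists_inP[i Pi /negPf Qi].
by rewrite (bigD1 i) //= Qi mul0r.
Qed.

Section SortSum.
Variables (B : finType) (bk : B -> nat).
Hypothesis bk_inj : injective bk.
Implicit Types (g : {ffun I -> B}) (h : {ffun I -> B * bool}).

(** In each block the negative label gets the even key just before the odd key of the positive one,
    so that parity is the sign read by [prec]. *)
Definition label_key (l : B * bool) : nat := (bk l.1).*2 + l.2.
Definition sorting h : 'S_N.+1 := (rho (fun a => label_key (h a)))^-1.
Definition blocks h : {ffun I -> B} := [ffun a => (h a).1].
Definition perm_invariant (W : {ffun I -> B} -> K) :=
  forall s g, W [ffun a => g (s a)] = W g.
Definition sortsum (W : {ffun I -> B} -> K) : KS :=
  \sum_h W (blocks h) *: ga_delta K (sorting h).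
Definition block_mono g := [forall i : 'I_N, (bk (g (lo i)) <= bk (g (hi i)))%N].
Definition cuts g : {set 'I_N} := [set i | g (lo i) != g (hi i)].


(** Inside a block, a descent is allowed iff the earlier letter is negative, an ascent iff the later
    one is positive: this is where [compat] comes from. *)
Lemma key_step (m p : nat) (a b : bool) (x y : nat) : x <> y ->
  ((m.*2 + a < p.*2 + b) || (m.*2 + a == p.*2 + b)
     && (if odd (m.*2 + a) then x < y else y < x))%N
  = (m <= p)%N && ((m != p) || (if (y < x)%N then ~~ a else b)).
Proof.
rewrite oddD odd_double oddb /= => xy.
have [yx | xy' | /esym/xy[]] := ltngtP y x; case: a; case: b => /=; lia.
Qed.

Lemma prec_sort g e s i :
  prec (fun a => label_key (g ((s^-1)%g a), e ((s^-1)%g a))) (s (lo i)) (s (hi i))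
  = (bk (g (lo i)) <= bk (g (hi i)))%N && ((i \in cuts g) || compat s e i).
Proof.
rewrite /prec !permK /label_key /= key_step ?inE ?(inj_eq bk_inj) //.
by move/val_inj/perm_inj/(congr1 val) => /=; rewrite /bump; lia.
Qed.

Lemma sort_eq g e s :
  (sorting [ffun a => (g ((s^-1)%g a), e ((s^-1)%g a))] == s)
  = block_mono g && [forall (i | i \notin cuts g), compat s e i].
Proof.
have -> : sorting [ffun a => (g ((s^-1)%g a), e ((s^-1)%g a))] =
    ((rho (fun a => label_key (g ((s^-1)%g a), e ((s^-1)%g a))))^-1)%g.
  by congr (rho _)^-1%g; apply/funext => a; rewrite ffunE.
rewrite rho_inv_eq; apply/forallP/andP => [H | [/forallP m /forall_inP c] i].
  split; [apply/forallP => i | apply/forall_inP => i /negPf ig]; have := H i;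
    by rewrite prec_sort => /andP[] //; rewrite ig.
rewrite prec_sort m /=; case: (boolP (i \in _)) => //=; exact: c.
Qed.

Lemma sum_pairs (F : {ffun I -> B * bool} -> K) (s : 'S_N.+1) :
  \sum_h F h = \sum_(g : {ffun I -> B}) \sum_(e : {ffun I -> bool})
    F [ffun a => (g (s a), e (s a))].
Proof.
rewrite pair_bigA /= (reindex (fun p : {ffun I -> B} * {ffun I -> bool} =>
  [ffun a => (p.1 (s a), p.2 (s a))])) //=.
exists (fun h => ([ffun a => (h ((s^-1)%g a)).1], [ffun a => (h ((s^-1)%g a)).2])).
  by case=> g e _; congr pair; apply/ffunP => a; rewrite !ffunE /= permKV.
by move=> h _; apply/ffunP => a; rewrite !ffunE /= permK -surjective_pairing.
Qed.

(** A labelling, read along a permutation [s], is a pair [(g, e)]; it sorts to [s] iff [g] is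
    monotone and [e] is compatible with [s] off the cuts of [g]. By invariance the weight sees only
    [g]. *)
Lemma sortsumE W : perm_invariant W ->
  sortsum W = \sum_(g | block_mono g) W g *: Theta (cuts g).
Proof.
move=> Winv; apply/ffunP => s; rewrite /sortsum !sum_ffunE.
rewrite [LHS](sum_pairs _ (s^-1)%g) [RHS]big_mkcond /=; apply: eq_bigr => g _.
have Wg e : W (blocks [ffun a => (g ((s^-1)%g a), e ((s^-1)%g a))]) = W g.
  by rewrite -[RHS](Winv (s^-1)%g); congr W; apply/ffunP => a; rewrite !ffunE.
under eq_bigr => e _.
  rewrite Wg !ffunE [s == _]eq_sym sort_eq; over.
case: (block_mono g) => /=; last by rewrite big1 // => e _; apply: mulr0.
rewrite !ffunE scaler_sumr; apply: eq_bigr => e _.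
by rewrite prod_bool.
Qed.
End SortSum.
End Theta.

(** * Products of sorting sums *)

Section SortProduct.
Local Open Scope ring_scope.
Variables (K : fieldType) (N : nat).
Local Notation I := 'I_N.+1.
Local Notation KS := (group_algebra K 'S_N.+1).
Variables (B1 B2 : finType) (bk1 : B1 -> nat) (bk2 : B2 -> nat) (q : nat).
Hypothesis bk1_inj : injective bk1.
Hypothesis bk2_inj : injective bk2.
Hypothesis bk2_lt : forall b, (bk2 b < q)%N.

(* Sorting by labels [l2] and then by labels [l1] is sorting by the pairs
   [(l1, l2)], the order of [l2] being reversed if [l1] is negative. *)
Definition bk3 (b : B1 * bool * B2) : nat :=
  (label_key bk1 b.1 * q + (if b.1.2 then bk2 b.2 else q.-1 - bk2 b.2))%N.

Lemma bk3_rem (b : B1 * bool * B2) :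
  ((if b.1.2 then bk2 b.2 else q.-1 - bk2 b.2) < q)%N.
Proof. by have := bk2_lt b.2; case: ifP; lia. Qed.

Lemma bk3_key b c : (bk3 b <= bk3 c)%N -> (label_key bk1 b.1 <= label_key bk1 c.1)%N.
Proof. by rewrite /bk3; have := bk3_rem c; case: leqP => //; nia. Qed.

Lemma key_inj (B : finType) (bk : B -> nat) : injective bk -> injective (label_key bk).
Proof.
move=> bi [b s] [c t]; rewrite /label_key /= => e.
have st : s = t by move/(congr1 odd): e; rewrite !oddD !odd_double !oddb.
by rewrite st in e *; move/addIn/double_inj/bi: e => ->.
Qed.

Lemma bk3_inj : injective bk3.
Proof.
move=> b c e; have e1 : b.1 = c.1.
  apply: (key_inj bk1_inj); apply/eqP; rewrite eqn_leq !bk3_key ?e //.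
case: b c e e1 => b1 b2 [c1 c2] /= + e1; rewrite e1 /bk3 /= => /addnI e.
congr pair; apply: bk2_inj; move: e; have := bk2_lt b2; have := bk2_lt c2.
by case: ifP; lia.
Qed.

(** Signs multiply, since reversing twice keeps the order. *)
Definition pair_label (l1 : B1 * bool) (l2 : B2 * bool) : B1 * bool * B2 * bool :=
  ((l1, l2.1), l1.2 == l2.2).

Lemma pair_label_step (l1 m1 : B1 * bool) (l2 m2 : B2 * bool) (x y : bool) :
  let P := label_key bk3 (pair_label l1 l2) in let Q := label_key bk3 (pair_label m1 m2) in
  ((P < Q) || (P == Q) && (if odd P then x else y))%N =
  ((label_key bk1 l1 < label_key bk1 m1) || (label_key bk1 l1 == label_key bk1 m1) &&
   (if odd (label_key bk1 l1)
    then (label_key bk2 l2 < label_key bk2 m2) || (label_key bk2 l2 == label_key bk2 m2) &&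
      (if odd (label_key bk2 l2) then x else y)
    else (label_key bk2 m2 < label_key bk2 l2) || (label_key bk2 m2 == label_key bk2 l2) &&
      (if odd (label_key bk2 m2) then y else x)))%N.
Proof.
case: l1 m1 l2 m2 => b1 s1 [c1 t1] [b2 s2] [c2 t2] /=.
have kb := bk3_rem (b1, s1, b2); have kc := bk3_rem (c1, t1, c2).
have hb := bk2_lt b2; have hc := bk2_lt c2.
have key2 (l : B2 * bool) : label_key bk2 l = ((bk2 l.1).*2 + l.2)%N by [].
have key3 l : label_key bk3 l = ((bk3 l.1).*2 + l.2)%N by [].
have [lt|lt|/(key_inj bk1_inj)[-> ->]] := ltngtP (label_key bk1 (b1, s1)) (label_key bk1
  (c1, t1)).
- apply/orP; left; rewrite !key3 /=; move: lt kb kc; rewrite /bk3 /=.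
  by case: (_ == _); case: (_ == _); nia.
- have : (label_key bk3 (pair_label (c1, t1) (c2, t2)) < label_key bk3 (pair_label (b1, s1)
  (b2, s2)))%N.
    rewrite !key3 /=; move: lt kb kc; rewrite /bk3 /=.
    by case: (_ == _); case: (_ == _); nia.
  by case: ltngtP.
rewrite !key3 !key2 /bk3 /= {kb kc key2 key3}; have -> : odd (label_key bk1 (c1, t1)) = t1.
  by rewrite /label_key oddD odd_double oddb.
move: (label_key bk1 (c1, t1) * q)%N => k; rewrite !oddD !odd_double !oddb.
case: t1 s2 t2 => [] [] [] /=; lia.
Qed.

(** Relabelling the first factor along the sorting permutation of the second, which the invariant
    weight [W] does not see, turns the product into sorting by pairs. *)
Lemma sortsumM (W : {ffun I -> B1} -> K) (V : {ffun I -> B2} -> K) :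
    perm_invariant W ->
  sortsum bk1 W * sortsum bk2 V =
  sortsum bk3 (fun g => W [ffun a => (g a).1.1] * V [ffun a => (g a).2]).
Proof.
move=> Winv; rewrite /sortsum mulr_sumr.
under eq_bigr => g _.
  rewrite mulr_suml (reindex_inj (h := fun f : {ffun I -> B1 * bool} =>
    [ffun b => f ((rho (fun a => label_key bk2 (g a)))^-1%g b)])) /=; last first.
    move=> f f' /ffunP e; apply/ffunP => a.
    by have := e (rho (fun a => label_key bk2 (g a)) a); rewrite !ffunE permK.
  over.
rewrite pair_bigA /= [RHS](reindex (fun p : {ffun I -> B2 * bool} * {ffun I -> B1 * bool} =>
  [ffun a => pair_label (p.2 a) (p.1 a)])) /=; last first.
  exists (fun h => ([ffun a => ((h a).1.2, (h a).1.1.2 == (h a).2)], [ffun a => (h a).1.1])).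
    case=> g f _; congr pair; apply/ffunP => a; rewrite !ffunE //=.
    by case: (g a) (f a) => ? [] [? []].
  move=> h _; apply/ffunP => a; rewrite !ffunE /pair_label /=.
  by case: (h a) => [[[? []] ?] []].
apply: eq_bigr => -[g f] _ /=.
rewrite -scalerAl -scalerAr scalerA ga_deltaM; congr (_ * _ *: ga_delta K _).
- rewrite -(Winv (rho (fun a => label_key bk2 (g a)))%g); congr W.
  by apply/ffunP => a; rewrite !ffunE permK.
- by congr V; apply/ffunP => a; rewrite !ffunE.
apply: rho_mul => a b; rewrite /prec !ffunE !permK pair_label_step.
by rewrite !rho_lt /prec.
Qed.
End SortProduct.

(** * Products of the elements [Theta C] *)

Section ThetaProduct.
Local Open Scope ring_scope.
Variables (K : fieldType) (N : nat).
Local Notation I := 'I_N.+1.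
Local Notation KS := (group_algebra K 'S_N.+1).
Implicit Types (s : 'S_N.+1) (C E T : {set 'I_N}).
Local Notation Theta := (Theta K).

Lemma block_mono_leq (B : finType) (bk : B -> nat) (g : {ffun I -> B}) (a b : I) :
  block_mono bk g -> (a <= b)%N -> (bk (g a) <= bk (g b))%N.
Proof.
move/forallP=> m; rewrite leq_eqVlt => /orP[/eqP/val_inj-> // | ].
apply: (ltn_adjacent (P := fun a b => (bk (g a) <= bk (g b))%N)) => // y x z.
exact: leq_trans.
Qed.

(** Rearranging preserves the number of labels with key below each [m], and these counts determine a
    monotone labelling. *)
Lemma block_mono_unique (B : finType) (bk : B -> nat) (g g' : {ffun I -> B}) s :
  injective bk -> block_mono bk g -> block_mono bk g' ->
  (forall a, g' a = g (s a)) -> g' = g.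
Proof.
move=> bi mg mg' e.
have card_eq (m : nat) : #|[set a | bk (g' a) < m]%N| = #|[set a | bk (g a) < m]%N|.
  have -> : [set a | bk (g' a) < m]%N = s @^-1: [set a | bk (g a) < m]%N.
    by apply/setP => a; rewrite !inE e.
  by rewrite card_preimset //; apply: perm_inj.
have le (f f' : {ffun I -> B}) : block_mono bk f -> block_mono bk f' ->
    (forall m : nat, #|[set a | bk (f' a) < m]%N| = #|[set a | bk (f a) < m]%N|) ->
    forall a, (bk (f' a) <= bk (f a))%N.
  move=> mf mf' ce a; rewrite leqNgt; apply/negP => lt.
  (* All positions up to [a] carry labels of [f] below [bk (f' a)], but labels of [f'] below it
     occur only before [a]. *)
  have : (#|[set b : I | b <= a]| <= #|[set b : I | b < a]|)%N.
    apply: (@leq_trans #|[set b | bk (f b) < bk (f' a)]%N|).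
      apply/subset_leq_card/subsetP => b; rewrite !inE => ba.
      by apply: leq_ltn_trans lt; apply: block_mono_leq.
    rewrite -ce; apply/subset_leq_card/subsetP => b; rewrite !inE ltnNge.
    by apply: contraR; rewrite -leqNgt => ?; apply: block_mono_leq.
  apply/negP; rewrite -ltnNge; apply: proper_card; apply/properP; split.
    by apply/subsetP => b; rewrite !inE => /ltnW.
  by exists a; rewrite !inE ?ltnn.
apply/ffunP => a; apply/bi/eqP; rewrite eqn_leq.
by rewrite (le g g') // (le g' g) // => m; rewrite card_eq.
Qed.

Lemma cuts0 (B : finType) (g : {ffun I -> B}) : cuts g = set0 -> forall a b, g a = g b.
Proof.
move=> c0; have adj : forall a b : I, (a < b)%N -> g a == g b.
  apply: ltn_adjacent => [y x z /eqP-> // | i].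
  by apply: contraT => gi; have := in_set0 i; rewrite -c0 inE gi.
move=> a b; case: (ltngtP a b) => [/adj/eqP // | /adj/eqP-> // | /val_inj-> //].
Qed.

Definition block_index C : {ffun I -> I} := [ffun a : I => inord #|[set i in C | i < a]%N|].

Lemma block_indexE C a : block_index C a = #|[set i in C | i < a]%N| :> nat.
Proof. by rewrite ffunE inordK // ltnS -[X in (_ <= X)%N]card_ord max_card. Qed.

Lemma block_index_hi C i :
  block_index C (hi i) = (block_index C (lo i) + (i \in C))%N :> nat.
Proof.
rewrite !block_indexE; have [iC | iC] := boolP (i \in C).
  rewrite addn1 (cardsD1 i) !inE iC val_hi ltnSn; congr _.+1; apply: eq_card => j.
  rewrite !inE ?val_hi ?val_lo; case: eqVneq => [-> | /=]; rewrite ?ltnn ?andbF //.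
  by rewrite -val_eqE /=; case: (_ \in _) => //=; lia.
rewrite addn0; apply: eq_card => j; rewrite !inE val_hi val_lo.
have [-> | ] := eqVneq j i; first by rewrite (negPf iC).
by rewrite -val_eqE /=; case: (_ \in _) => //=; lia.
Qed.

Lemma block_index_mono C : block_mono val (block_index C).
Proof. by apply/forallP => i; rewrite /= block_index_hi leq_addr. Qed.

Lemma cuts_block_index C : cuts (block_index C) = C.
Proof.
apply/setP => i; rewrite inE -val_eqE /= block_index_hi -[X in X == _]addn0 eqn_add2l.
by case: (_ \in _).
Qed.

(** The labellings whose label multiplicities are the block sizes of [C]. *)
Definition block_type C (g : {ffun I -> I}) : bool :=
  [exists s : 'S_N.+1, [forall a, g a == block_index C (s a)]].

Lemma block_typeP C (g : {ffun I -> I}) :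
  reflect (exists s : 'S_N.+1, forall a, g a = block_index C (s a)) (block_type C g).
Proof.
by apply: (iffP existsP) => -[s H]; exists s; [move=> a;
  apply/eqP/(forallP H)|apply/forallP=> a; apply/eqP].
Qed.

Lemma block_type_inv C : perm_invariant (fun g => (block_type C g)%:R : K).
Proof.
move=> s g; congr (nat_of_bool _)%:R; apply/block_typeP/block_typeP => -[t e].
  by exists (s^-1 * t)%g => a; rewrite permM -e ffunE permKV.
by exists (s * t)%g => a; rewrite permM -e ffunE.
Qed.

Lemma block_type_mono C (g : {ffun I -> I}) : block_mono val g -> block_type C g = (g ==
  block_index C).
Proof.
move=> mg; apply/block_typeP/eqP => [[s] | ->].
  exact: (block_mono_unique val_inj (block_index_mono C)).
by exists 1%g => a; rewrite perm1.
Qed.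

(** The only monotone labelling of type [C] is [block_index C], so [sortsumE] leaves one term. *)
Lemma sortsum_Theta C : sortsum val (fun g => (block_type C g)%:R) = Theta C.
Proof.
rewrite (sortsumE val_inj (block_type_inv C)) (bigD1 (block_index C)) ?block_index_mono //=.
rewrite block_type_mono ?block_index_mono // eqxx scale1r cuts_block_index big1 ?addr0 //.
by move=> g /andP[mg /negPf ne]; rewrite block_type_mono // ne scale0r.
Qed.

(** The [g] label by triples: a block of [C], a sign, a block of [E]. The three clauses serve
    triangularity, left multiplication on [Fil 1], and nonvanishing of the leading term of a
    square. *)
Lemma Theta_mulE C E : exists2 w : {ffun I -> I * bool * I} -> bool,
  Theta C * Theta E =
    \sum_(g | block_mono (bk3 val val N.+1) g && w g) Theta (cuts g)
  & [/\ forall g, block_mono (bk3 val val N.+1) g -> w g -> C \subset cuts g,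
        forall g, w g -> cuts g = set0 -> E = set0
      & C = E -> exists g, [/\ block_mono (bk3 val val N.+1) g, w g & cuts g = C]].
Proof.
have bi : injective (bk3 (val : I -> nat) (val : I -> nat) N.+1).
  by apply: bk3_inj => [||b]; [exact: val_inj | exact: val_inj | exact: ltn_ord].
pose w (g : {ffun I -> I * bool * I}) :=
  block_type C [ffun a => (g a).1.1] && block_type E [ffun a => (g a).2].
have winv : perm_invariant (fun g : {ffun I -> I * bool * I} => (w g)%:R : K).
  move=> s g; rewrite /w -!mulnb !natrM.
  congr (_ * _).
    by rewrite -[RHS](block_type_inv C s); congr (block_type C _)%:R; apply/ffunP => a;
      rewrite !ffunE.
  by rewrite -[RHS](block_type_inv E s); congr (block_type E _)%:R; apply/ffunP => a;
    rewrite !ffunE.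
have rowm (g : {ffun I -> I * bool * I}) : block_mono (bk3 val val N.+1) g ->
    block_mono val [ffun a => (g a).1.1].
  move/forallP => mg; apply/forallP => i; rewrite !ffunE.
  have := bk3_key (@ltn_ord N.+1) (mg i); rewrite /label_key.
  by case: (g (lo i)) (g (hi i)) => [[a []] ?] [[b []] ?] /=; lia.
exists w; last split=> [g mg /andP[+ _] | g /andP[_ /block_typeP[s e]] /cuts0 g0 | CE].
- rewrite -(sortsum_Theta C) -(sortsum_Theta E).
  rewrite (sortsumM val_inj (@ltn_ord N.+1) _ (block_type_inv C)).
  transitivity (sortsum (bk3 (val : I -> nat) (val : I -> nat) N.+1) (fun g => (w g)%:R : K)).
    by apply: eq_bigr => h _; rewrite -natrM mulnb.
  rewrite (sortsumE bi winv) big_mkcondr; apply: eq_bigr => g _.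
  by case: ifP; rewrite ?scale1r ?scale0r.
- rewrite block_type_mono ?rowm // => /eqP/ffunP e.
  rewrite -[C]cuts_block_index; apply/subsetP => i; rewrite !inE -!e !ffunE.
  by apply: contra => /eqP ->.
- rewrite -[E]cuts_block_index; apply/setP => i; rewrite !inE; apply/negbTE; rewrite negbK.
  by rewrite -(permKV s (lo i)) -(permKV s (hi i)) -!e !ffunE (g0 _ ((s^-1)%g (hi i))).
(* With equal block labels and positive signs, no block of [C] is cut further. *)
exists [ffun a => ((block_index C a, true), block_index C a)]; split.
- apply/forallP => i; move: (forallP (block_index_mono C) i).
  rewrite !ffunE /bk3 /label_key /= => le; apply: leq_add => //.
  by rewrite leq_mul2r leq_add2r leq_double le orbT.
- apply/andP; rewrite -CE; split; apply/block_typeP; exists 1%g => a;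
    by rewrite !ffunE perm1.
rewrite -[RHS]cuts_block_index; apply/setP => i; rewrite !inE !ffunE.
by rewrite !xpair_eqE eqxx andbT andbb.
Qed.
End ThetaProduct.

(** * The filtration by the number of cuts *)

Section Filtration.
Local Open Scope ring_scope.
Variables (K : fieldType) (N : nat).
Local Notation I := 'I_N.+1.
Local Notation KS := (group_algebra K 'S_N.+1).
Implicit Types (s : 'S_N.+1) (C E T : {set 'I_N}).
Local Notation Theta := (Theta K).

Lemma prod_if (T : finType) (R : pzSemiRingType) (P : pred T) (F : T -> R) :
  \prod_i (if P i then F i else 1) = \prod_(i | P i) F i.
Proof. by rewrite [RHS]big_mkcond. Qed.

(* Both sides count sign sequences: expanding the alternating sum turns each
   factor [compat] into its negation, and flipping all signs turns it back. *)
Lemma Theta_alternating C :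
  \sum_(E : {set 'I_N} | C \subset E) (-1) ^+ #|E| *: Theta E = (-1) ^+ N *: Theta C.
Proof.
apply/ffunP => s; rewrite sum_ffunE !ffunE.
under eq_bigr do rewrite !ffunE scaler_sumr.
rewrite exchange_big scaler_sumr /=.
rewrite [RHS](reindex_inj (h := fun e : {ffun I -> bool} => [ffun a => ~~ e a])) /=; last first.
  by move=> e f /ffunP ef; apply/ffunP => a; have := ef a; rewrite !ffunE => /negb_inj.
apply: eq_bigr => e _.
pose F (i : 'I_N) : K := -1; pose G i : K := if i \in C then 0 else (compat s e i)%:R.
transitivity (\prod_i (F i + G i)).
  rewrite bigA_distr big_mkcond /=; apply: eq_bigr => E _; case: ifPn => [CE | nCE].
    rewrite [RHS](bigID (mem E)) /=.
    rewrite -[LHS]/((-1) ^+ #|E| * \prod_(i | i \notin E) (compat s e i)%:R : K).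
    congr (_ * _).
      by rewrite -prodr_const; apply: eq_bigr => i ->.
    apply: eq_bigr => i iE; rewrite (negPf iE) /G; case: ifPn => // iC.
    by rewrite (subsetP CE) in iE.
  have /subsetPn[i iC iE] := nCE.
  by rewrite (bigD1 i) //= (negPf iE) /G iC mul0r.
have -> : (-1) ^+ N = \prod_(i : 'I_N) (-1) :> K by rewrite prodr_const card_ord.
rewrite -[RHS]/((\prod_(i : 'I_N) (-1)) * (\prod_(i | i \notin C)
  (compat s [ffun a => ~~ e a] i)%:R) : K).
rewrite -[X in _ * X]prod_if -big_split /=; apply: eq_bigr => i _.
rewrite /F /G; case: (boolP (i \in C)) => iC /=; first by rewrite addr0 mulr1.
by rewrite /compat !ffunE; case: desc; case: (e _); rewrite /=; ring.
Qed.

Definition Fil (k : nat) : {vspace KS} :=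
  <<[seq Theta C | C : {set 'I_N} in [pred C : {set 'I_N} | (k <= #|C|)%N]]>>%VS.

Lemma Theta_Fil k C : (k <= #|C|)%N -> Theta C \in Fil k.
Proof. by move=> kC; apply/memv_span/imageP; exists C. Qed.

Lemma Fil_subP k (U : {vspace KS}) :
  (forall C, (k <= #|C|)%N -> Theta C \in U) -> (Fil k <= U)%VS.
Proof. by move=> H; apply/span_subvP => _ /imageP[C kC ->]; apply: H. Qed.

Lemma Fil_le k l : (k <= l)%N -> (Fil l <= Fil k)%VS.
Proof. by move=> kl; apply: Fil_subP => C lC; apply/Theta_Fil/(leq_trans kl). Qed.

Lemma Fil_gtN k : (N < k)%N -> Fil k = 0%VS.
Proof.
move=> Nk; apply/eqP; rewrite -subv0; apply: Fil_subP => C kC.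
by have := max_card C; rewrite card_ord => /(leq_trans kC)/(leq_trans Nk); rewrite ltnn.
Qed.

(** For [#|C| = k], the element [Theta C] has opposite coefficients on the two sides of
    [Theta_alternating], so twice [Theta C] is a combination of elements with more cuts. *)
Lemma Fil_parity k : (2%:R != 0 :> K) -> odd (N + k) -> Fil k = Fil k.+1.
Proof.
move=> two Nk; apply/eqP; rewrite eqEsubv (Fil_le (leqnSn k)) andbT; apply: Fil_subP => C.
rewrite leq_eqVlt => /predU1P[kC | ]; last exact: Theta_Fil.
have := Theta_alternating C; rewrite (bigD1 C) //= -kC.
have -> : (-1) ^+ N = - (-1) ^+ k :> K.
  by rewrite -signr_odd -[in RHS]signr_odd; move: Nk; rewrite oddD; case: odd;
    case: odd => //= _; rewrite ?expr0 ?expr1 ?opprK.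
set S := \sum_(_ | _) _ => e; have {e} : (2%:R * (-1) ^+ k) *: Theta C \in Fil k.+1.
  have -> : (2%:R * (-1) ^+ k) *: Theta C = - S.
    by apply/eqP; rewrite -addr_eq0 mulr_natl mulr2n scalerDl -addrA e scaleNr subrr.
  rewrite rpredN; apply: rpred_sum => E /andP[CE EC].
  rewrite rpredZ // Theta_Fil // kC; apply: proper_card.
  by rewrite properEneq eq_sym EC.
by rewrite rpredZeq mulf_eq0 (negPf two) signr_eq0.
Qed.

(** All cut sets in [Theta C * Theta E] contain [C]; those equal to [C] contribute to the scalar. *)
Lemma Theta_mul C x : x \in Fil 0 ->
  exists c, Theta C * x - c *: Theta C \in Fil #|C|.+1.
Proof.
pose U := (<[Theta C]> + Fil #|C|.+1)%VS.
suff H : (amull (Theta C) @: Fil 0 <= U)%VS.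
  move=> x0; have /(subvP H) : amull (Theta C) x \in (amull (Theta C) @: Fil 0)%VS.
    exact: memv_img.
  rewrite lfunE /= => /memv_addP[_ /vlineP[c ->] [w wF ->]].
  by exists c; rewrite addrAC subrr add0r.
apply/subvP => _ /memv_imgP[y yF ->].
suff : (Fil 0 <= amull (Theta C) @^-1: U)%VS.
  by move/subvP/(_ y yF); rewrite -memv_preim.
apply: Fil_subP => E _; rewrite -memv_preim lfunE /=.
have [w -> [wC _ _]] := Theta_mulE K C E.
apply: rpred_sum => g /andP[mg wg]; have := wC g mg wg.
rewrite subEproper => /predU1P[<- | /proper_card lt].
  by apply: (subvP (addvSl _ _)); apply: memv_line.
by apply: (subvP (addvSr _ _)); apply: Theta_Fil.
Qed.

Lemma Theta_mul_Fil1 C E : E != set0 -> Theta C * Theta E \in Fil 1.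
Proof.
move=> E0; have [w -> [_ w0 _]] := Theta_mulE K C E.
apply: rpred_sum => g /andP[_ wg]; apply: Theta_Fil; rewrite card_gt0.
by apply: contra E0 => /eqP/(w0 g wg)/eqP.
Qed.

(** The scalar counts the labellings with cut set [C], of which at least one exists. *)
Lemma Theta_sqr C : exists2 c : nat, (0 < c)%N &
  Theta C * Theta C - c%:R *: Theta C \in Fil #|C|.+1.
Proof.
have [w -> [wC _ wE]] := Theta_mulE K C C.
have [g0 [mg0 wg0 cg0]] := wE erefl.
exists #|[pred g | [&& block_mono (bk3 val val N.+1) g, w g & cuts g == C]]|.
  by apply/card_gt0P; exists g0; rewrite inE mg0 wg0 cg0 eqxx.
rewrite (bigID (fun g => cuts g == C)) /= scaler_nat -sumr_const addrAC -[X in X + _]opprB.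
rewrite [X in X - _](_ : _ = \sum_(g | (block_mono (bk3 val val N.+1) g && w g) && (cuts g
  == C)) Theta (cuts g)).
  rewrite subrr oppr0 add0r; apply: rpred_sum => g /andP[/andP[mg wg] ne].
  by apply/Theta_Fil/proper_card; rewrite properEneq eq_sym ne wC.
by apply: eq_big => [g | g /and3P[_ _ /eqP->]] //; rewrite inE andbA.
Qed.

Lemma Fil_mulr k x : x \in Fil 0 -> forall y, y \in Fil k -> y * x \in Fil k.
Proof.
move=> x0 y; suff : (Fil k <= amulr x @^-1: Fil k)%VS.
  by move/subvP => H /H; rewrite -memv_preim lfunE.
apply: Fil_subP => C kC; rewrite -memv_preim lfunE /=.
have [c] := Theta_mul C x0; rewrite -[X in X \in _ -> _]/(_ - _).
move/(subvP (Fil_le (leqW kC))) => H.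
by rewrite -[X in X \in _](subrK (c *: Theta C)) rpredD // rpredZ // Theta_Fil.
Qed.
End Filtration.

(** * The peak algebra as the span of the elements [Theta C] *)

Section PeakSpan.
Local Open Scope ring_scope.
Variables (K : fieldType) (N : nat).
Local Notation I := 'I_N.+1.
Local Notation KS := (group_algebra K 'S_N.+1).
Implicit Types (s : 'S_N.+1) (C E : {set 'I_N}) (P T : {set I}).
Local Notation Theta := (Theta K).

Lemma lo_inj : injective (@lo N).
Proof. by move=> i j /(congr1 val) /= /val_inj. Qed.

Lemma hi_inj : injective (@hi N).
Proof. exact: lift_inj. Qed.

Lemma PeakP s j :
  reflect (exists i i' : 'I_N, [/\ hi i = j, lo i' = j, ~~ desc s i & desc s i'])
          (j \in Peak s).
Proof.
rewrite inE; apply: (iffP existsP) => [[a /existsP[b /and4P[/eqP ja /eqP bj sa sb]]] | ].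
  have aN : (a < N)%N by have := ltn_ord j; lia.
  have jN : (j < N)%N by have := ltn_ord b; lia.
  exists (Ordinal aN), (Ordinal jN).
  have -> : hi (Ordinal aN) = j by apply: val_inj; rewrite /= /bump; lia.
  have lj : lo (Ordinal jN) = j by apply: val_inj.
  have la : lo (Ordinal aN) = a by apply: val_inj.
  have hb : hi (Ordinal jN) = b by apply: val_inj; rewrite /= /bump; lia.
  have ha : hi (Ordinal aN) = j by apply: val_inj; rewrite /= /bump; lia.
  by rewrite /desc ha la lj hb sb -leqNgt ltnW.
case=> i [i' [hij lij asc dsc]]; exists (lo i); apply/existsP; exists (hi i').
rewrite /desc lij in dsc; rewrite /desc hij -leqNgt leq_eqVlt in asc.
have ej : j = i.+1 :> nat by rewrite -hij.
have ej' : j = i' :> nat by rewrite -lij.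
rewrite dsc andbT; apply/and3P; split; [by rewrite ej | by rewrite /= /bump ej' | ].
case/orP: asc => [/eqP/val_inj/perm_inj/(congr1 val) /= e | //].
by move: ej; rewrite e => /eqP; rewrite -[X in X == _]addn0; lia.
Qed.

Definition no_inner_peak s C : bool :=
  [forall i, forall i', (hi i == lo i') && ~~ desc s i && desc s i' ==> (i \in C) || (i'
    \in C)].

(** Each [i] outside [C] prescribes one sign: negative at the start of a descent, positive at the
    end of an ascent. Two demands conflict exactly at an inner peak; otherwise [N - #|C|] signs are
    fixed and [#|C|.+1] are free. *)
Lemma Theta_val C s : Theta C s = if no_inner_peak s C then 2%:R ^+ #|C|.+1 else 0.
Proof.
rewrite ffunE; under eq_bigr do rewrite prod_bool.
case: ifPn => [good | bad]; last first.
  rewrite big1 // => e _; case: forall_inP => // ce; case/negP: bad.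
  apply/forallP => i; apply/forallP => i'; apply/implyP => /andP[/andP[/eqP ii' di] di'].
  apply: contraT; rewrite negb_or => /andP[iC iC'].
  by have := ce _ iC; have := ce _ iC'; rewrite /compat (negPf di) di' -ii' => /negPf ->.
(* [A1] and [A0] are the positions whose sign is forced to be positive and negative. *)
pose A1 := [set hi i | i in [set i | (i \notin C) && ~~ desc s i]].
pose A0 := [set lo i | i in [set i | (i \notin C) && desc s i]].
have dis : [disjoint A1 & A0].
  apply/pred0P => j /=; apply/negP => /andP[/imsetP[i + ->] /imsetP[i' + ii']].
  rewrite !inE => /andP[iC di] /andP[iC' di'].
  have := forallP (forallP good i) i'.
  by rewrite ii' eqxx di di' (negPf iC) (negPf iC').
have cA : (#|A1| + #|A0| = N - #|C|)%N.
  rewrite (card_imset _ hi_inj) (card_imset _ lo_inj) (_ : N - #|C| = #|~: C|)%N; last first.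
    by have := cardsC C; rewrite card_ord; lia.
  rewrite -(cardsID [set i | desc s i] (~: C)) addnC; congr (_ + _)%N; apply: eq_card => i;
  by rewrite !inE // andbC.
transitivity (\prod_j \sum_(b : bool) (((j \in A1) ==> b) && ((j \in A0) ==> ~~ b))%:R : K).
  rewrite bigA_distr_bigA; apply: eq_bigr => e _; rewrite prod_bool; congr (nat_of_bool _)%:R.
  apply/forall_inP/forallP => [ce j | H i iC].
    apply/andP; split; apply/implyP => /imsetP[i]; rewrite inE => /andP[iC di] ->;
    by have := ce i iC; rewrite /compat ?di ?(negPf di).
  rewrite /compat; case: ifPn => di.
    have /andP[_ /implyP] := H (lo i); apply.
    by apply: imset_f; rewrite inE iC di.
  have /andP[/implyP h _] := H (hi i); apply: h.
  by apply: imset_f; rewrite inE iC di.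
transitivity (\prod_(j | j \notin A1 :|: A0) 2%:R : K).
  rewrite [RHS]big_mkcond /=; apply: eq_bigr => j _; rewrite big_bool /= inE.
  have := pred0P dis j => /=.
  by case: (j \in A1); case: (j \in A0) => //= _; rewrite ?addr0 ?add0r -?natrD.
rewrite prodr_const; congr (_ ^+ _).
transitivity #|~: (A1 :|: A0)|; first by apply: eq_card => j; rewrite inE.
have := cardsC (A1 :|: A0); rewrite cardsU (disjoint_setI0 dis) cards0 subn0 cA card_ord.
by have := max_card C; rewrite card_ord; lia.
Qed.

Lemma Peak_inner s : Peak s \in powerset (inner_positions N.+1).
Proof.
rewrite inE; apply/subsetP => j /PeakP[i [i' [<- e _ _]]]; rewrite inE /=.
by move: (congr1 val e) (ltn_ord i') => /= <-; rewrite /bump.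
Qed.

Lemma peak_algebraP (x : KS) :
  (forall s t, Peak s = Peak t -> x s = x t) -> x \in peak_algebra K N.+1.
Proof.
move=> xP; pose c P := if [pick s | Peak s == P] is Some s then x s else 0.
have cE s : c (Peak s) = x s.
  by rewrite /c; case: pickP => [t /eqP/xP // | /(_ s)]; rewrite eqxx.
suff -> : x = \sum_(P in powerset (inner_positions N.+1)) c P *: peak_sum K P.
  by apply: rpred_sum => P Pi; rewrite rpredZ //; apply/memv_span/imageP; exists P.
apply/ffunP => s; rewrite sum_ffunE (bigD1 (Peak s)) ?Peak_inner //= big1 ?addr0.
  rewrite ffunE /peak_sum sum_ffunE (bigD1 s) //= big1 ?addr0 => [|t /andP[_ ts]].
    by rewrite !ffunE eqxx cE /GRing.scale /= mulr1.
  by rewrite ffunE eq_sym (negPf ts).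
move=> P /andP[_ PS]; rewrite ffunE /peak_sum sum_ffunE big1 ?scaler0 // => t /eqP tP.
by rewrite ffunE; case: eqVneq => // st; rewrite st tP eqxx in PS.
Qed.

(** The condition depends on [s] only through its peak set, which puts [Theta C] in the peak
    algebra. *)
Lemma no_inner_peakE s C :
  no_inner_peak s C = 
  [forall j in Peak s, [forall i, (hi i == j) ==>
    [forall i', (lo i' == j) ==> (i \in C) || (i' \in C)]]].
Proof.
apply/forallP/forall_inP => [H j /PeakP[i [i' [hij lij di di']]] | H i].
  apply/forallP => k; apply/implyP => /eqP hk; apply/forallP => k'; apply/implyP => /eqP lk.
  have -> : k = i by apply: hi_inj; rewrite hk.
  have -> : k' = i' by apply: lo_inj; rewrite lk.
  by have := forallP (H i) i'; rewrite hij lij eqxx di di'.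
apply/forallP => i'; apply/implyP => /andP[/andP[/eqP ii' di] di'].
have jP : hi i \in Peak s by apply/PeakP; exists i, i'.
by have := forallP (H _ jP) i; rewrite eqxx /= => /forallP/(_ i'); rewrite ii' eqxx.
Qed.

Lemma Theta_peak_algebra C : Theta C \in peak_algebra K N.+1.
Proof. by apply: peak_algebraP => s t st; rewrite !Theta_val !no_inner_peakE st. Qed.


Definition avoid T : KS := [ffun s => [disjoint Peak s & T]%:R].

Definition isolated_gap T (j : I) : bool :=
  (j \notin T) && [exists i, exists i' : 'I_N, [&& hi i == j, lo i' == j, lo i \in T & hi
    i' \in T]].

Hypothesis two : 2%:R != 0 :> K.

Lemma Peak_adjacent s (i : 'I_N) : lo i \in Peak s -> hi i \notin Peak s.
Proof.
move=> /PeakP[k [k' [_ /lo_inj-> _ di]]]; apply/PeakP => -[l [l' [/hi_inj-> _ + _]]].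
by rewrite di.
Qed.

(** Cut between neighbours that both miss [T]. Positions in [T] touch no cut and, without isolated
    gaps, every possible peak outside [T] touches one; so the inner peaks are those in [T]. *)
Lemma avoid_no_gap T : (forall j, ~~ isolated_gap T j) -> avoid T \in Fil K N 0.
Proof.
move=> ng; pose C := [set i | (lo i \notin T) && (hi i \notin T)].
suff -> : avoid T = (2%:R ^+ #|C|.+1)^-1 *: Theta C by rewrite rpredZ ?Theta_Fil.
apply/ffunP => s; rewrite [RHS]ffunE [LHS]ffunE Theta_val.
have -> : [disjoint Peak s & T] = no_inner_peak s C.
  rewrite no_inner_peakE; apply/pred0P/forall_inP => [H j jP | H j].
    apply/forallP => i; apply/implyP => /eqP hij; apply/forallP => i'; apply/implyP => /eqP lij.
    have jT : j \notin T by have /= := H j; rewrite jP /= => ->.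
    rewrite !inE hij lij jT andbT; have := ng j; rewrite /isolated_gap jT /=.
    by apply: contraR; rewrite negb_or !negbK => /andP[iT i'T];
      apply/existsP; exists i; apply/existsP; exists i'; rewrite hij lij iT i'T !eqxx.
  apply/negP => /andP[jP jT]; have {}jT : j \in T by [].
  have [i [i' [hij lij _ _]]] := PeakP _ _ jP.
  have := forallP (H j jP) i; rewrite hij eqxx /= => /forallP/(_ i').
  by rewrite lij eqxx /= !inE hij lij jT andbF.
case: ifP; rewrite ?scaler0 // => _.
by rewrite /GRing.scale /= mulVf // expf_neq0.
Qed.

(* If [j] is a gap with both neighbours in [T], then a permutation with a peak
   at [j] has none next to [j], so the left neighbour may be dropped. *)
Lemma avoid_split T (i i' : 'I_N) : hi i = lo i' -> lo i \in T -> hi i' \in T ->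
  avoid T = avoid (hi i |: T) + (avoid (T :\ lo i) - avoid (hi i |: (T :\ lo i))).
Proof.
move=> ii' iT i'T; apply/ffunP => s; rewrite !ffunE.
have dU j S : [disjoint Peak s & j |: S] = (j \notin Peak s) && [disjoint Peak s & S].
  by rewrite disjoint_sym disjoints_subset subUset sub1set inE -disjoints_subset disjoint_sym.
rewrite !dU; case: (boolP (hi i \in Peak s)) => jP /=; last first.
  by rewrite subrr addr0.
rewrite subr0 add0r; congr (nat_of_bool _)%:R.
have lP : lo i \notin Peak s by apply: contraL jP; apply: Peak_adjacent.
rewrite -[in LHS](setD1K iT) dU lP.
done.
Qed.

(** Induction on [k]: a gap at the last permitted position is split by [avoid_split]; the resulting
    sets have no gap there, and new gaps only further left. *)
Lemma avoid_Fil_from k T :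
  (forall j : I, (k <= j)%N -> ~~ isolated_gap T j) -> avoid T \in Fil K N 0.
Proof.
elim: k T => [|k IH] T gk; first by apply: avoid_no_gap => j; apply: gk.
have [[j gj jk] | ng] := pselect (exists2 j : I, isolated_gap T j & j = k :> nat); last first.
  apply: IH => j; rewrite leq_eqVlt => /predU1P[e | /gk //].
  by apply/negP => gj; apply: ng; exists j.
case/andP: (gj) => jT /existsP[i /existsP[i' /and4P[/eqP hij /eqP lij iT i'T]]].
have ei : k = i.+1 by rewrite -jk -hij.
have ei' : k = i' by rewrite -jk -lij.
rewrite (avoid_split _ iT i'T) ?hij ?lij //.
have ok (S : {set I}) : (forall l : I, (k < l)%N -> (l \in S) = (l \in T)) ->
    ((j \in S) || (lo i \notin S)) -> avoid S \in Fil K N 0.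
  move=> ST jS; apply: IH => l; rewrite leq_eqVlt => /predU1P[kl | kl].
    have -> : l = j by apply: val_inj; rewrite /= -kl jk.
    rewrite /isolated_gap; apply/negP => /andP[jnS].
    case/existsP => m /existsP[m' /and4P[/eqP hm _ mS _]].
    rewrite (negPf jnS) /= in jS; have em : m = i by apply: hi_inj; rewrite hm hij.
    by rewrite em (negPf jS) in mS.
  have := gk l kl; rewrite /isolated_gap ST //; apply: contra => /andP[lT].
  case/existsP => m /existsP[m' /and4P[/eqP hm /eqP lm mS m'S]].
  rewrite lT; apply/existsP; exists m; apply/existsP; exists m'.
  have em : l = m.+1 :> nat by rewrite -hm.
  have em' : l = m' :> nat by rewrite -lm.
  rewrite hm lm !eqxx /= -(ST (hi m')) ?m'S ?andbT; last first.
    by rewrite [nat_of_ord _]val_hi -em' ltnW.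
  have [km | mk] := ltnP k (lo m); first by rewrite -ST.
  (* Here [l = k + 1], which is in [T] as the right neighbour of the gap. *)
  case/negP: lT; have -> // : l = hi i'.
  by apply: val_inj; move: mk kl; rewrite em [val (hi i')]val_hi -ei' [LHS]em /=; lia.
have nj (l : I) : (k < l)%N -> (l == j) = false by move=> kl; apply/eqP => e;
  rewrite -jk e ltnn in kl.
have ni (l : I) : (k < l)%N -> (l == lo i) = false.
  by move=> kl; apply/eqP => e; move: kl; rewrite e ei /=; lia.
rewrite rpredD ?rpredB //; (apply: ok => [l kl | ];
  [by rewrite !inE ?(nj l kl) ?(ni l kl) | by rewrite !inE ?eqxx /= ?orbT]).
Qed.

Lemma avoid_Fil T : avoid T \in Fil K N 0.
Proof. by apply: (@avoid_Fil_from N.+1) => j; rewrite leqNgt ltn_ord. Qed.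

(** Avoiding the complement of [P] means having all peaks in [P]; so [peak_sum K P] is such a sum
    minus the [peak_sum K Q] for proper subsets [Q], handled by induction. *)
Lemma peak_sum_Fil (P : {set 'I_N.+1}) : peak_sum K P \in Fil K N 0.
Proof.
have [d] := ubnP #|P|; elim: d P => // d IH P Pd.
have e : avoid (~: P) = \sum_(Q : {set I} | Q \subset P) peak_sum K Q.
  apply/ffunP => s; rewrite ffunE sum_ffunE -subsets_disjoint.
  have pE Q : peak_sum K Q s = (Q == Peak s)%:R.
    rewrite /peak_sum sum_ffunE; case: eqVneq => [-> | ne].
      rewrite (bigD1 s) //= ffunE eqxx big1 ?addr0 // => t /andP[_ ts].
      by rewrite ffunE eq_sym (negPf ts).
    rewrite big1 // => t /eqP tQ; rewrite ffunE; case: eqVneq => // st.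
    by rewrite -tQ st eqxx in ne.
  under eq_bigr do rewrite pE.
  case: (boolP (Peak s \subset P)) => sP.
    by rewrite (bigD1 (Peak s)) //= eqxx big1 ?addr0 // => Q /andP[_ /negPf ->].
  by rewrite big1 // => Q QP; case: eqVneq => // QS; rewrite -QS QP in sP.
have := avoid_Fil (~: P); rewrite e (bigD1 P) //= => H.
rewrite -[peak_sum K P](addrK (\sum_(Q : {set I} | (Q \subset P) && (Q != P)) peak_sum K Q)).
rewrite rpredB // rpred_sum // => Q /andP[QP ne]; apply: IH.
by apply: (@leq_trans #|P|) => //; apply: proper_card; rewrite properEneq ne.
Qed.

Lemma peak_algebra_Fil : peak_algebra K N.+1 = Fil K N 0.
Proof.
apply/eqP; rewrite eqEsubv; apply/andP; split.
  by apply/span_subvP => _ /imageP[P _ ->]; apply: peak_sum_Fil.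
by apply: Fil_subP => C _; apply: Theta_peak_algebra.
Qed.
End PeakSpan.

(** * Upper bound: the radical and the filtration *)

Section RadicalFiltration.
Local Open Scope ring_scope.
Variables (K : fieldType) (N : nat).
Local Notation KS := (group_algebra K 'S_N.+1).
Implicit Types (C : {set 'I_N}).
Local Notation Theta := (Theta K).
Local Notation Fil := (Fil K N).
Local Notation R := (radical (Fil 0)).
Hypothesis charK0 : [pchar K] =i pred0.

Let natr_neq0 n : (0 < n)%N -> n%:R != 0 :> K.
Proof. by move=> n0; rewrite ((pcharf0P K).1 charK0) -lt0n. Qed.

Lemma Fil0_mul : (Fil 0 * Fil 0 <= Fil 0)%VS.
Proof. by apply/prodvP => x y x0 y0; apply: Fil_mulr. Qed.

(** If the eigenvalue [c] is nonzero, the radical element [- c^-1 *: x] sends [Theta C] to its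
    negative modulo [Fil #|C|.+1]; then [radical_qinj] puts [Theta C] itself into [Fil #|C|.+1]. *)
Lemma Theta_radical C x : x \in R -> Theta C * x \in Fil #|C|.+1.
Proof.
move=> xR; have x0 := radical_sub xR.
have [c] := Theta_mul C x0; have [-> | c0] := eqVneq c 0; first by rewrite scale0r subr0.
move=> H; suff TF : Theta C \in Fil #|C|.+1.
  by rewrite -[Theta C * x](subrK (c *: Theta C)) rpredD // rpredZ.
have xR' : - c^-1 *: x \in R by rewrite rpredZ.
apply: (radical_qinj Fil0_mul xR' (Fil_le _ _ (leq0n _))); last 2 first.
- exact: Theta_Fil.
- rewrite -scalerAr -[X in X + _]scale1r -(mulVf c0) -scalerA scaleNr -scalerBr.
  by rewrite rpredZ // -opprB rpredN.
by apply/prodvP => y z yF z0; apply: Fil_mulr.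
Qed.

Lemma Fil_radical k x y : x \in R -> y \in Fil k -> y * x \in Fil k.+1.
Proof.
move=> xR yF; suff : (Fil k <= amulr x @^-1: Fil k.+1)%VS.
  by move/subvP/(_ y yF); rewrite -memv_preim lfunE.
apply: Fil_subP => C kC; rewrite -memv_preim lfunE /=.
by apply: (subvP (Fil_le K N _)) (Theta_radical C xR).
Qed.

(** Applied to the extreme layers [k = 0] and [k = N]. If [c] is the coefficient of [Theta C] in
    [x], then [Theta C * x] in [Fil k.+1] forces [c] times the square of [Theta C] into it, and this
    square is a positive multiple of [Theta C] modulo [Fil k.+1]. *)
Lemma radical_Fil_unique k C x : (forall E : {set 'I_N}, #|E| = k -> E = C) -> #|C| = k ->
    (forall w, w \in Fil k.+1 -> Theta C * w \in Fil k.+1) ->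
  x \in R -> x \in Fil k -> x \in Fil k.+1.
Proof.
move=> uC kC Cw xR xF.
have : (Fil k <= <[Theta C]> + Fil k.+1)%VS.
  apply: Fil_subP => E; rewrite leq_eqVlt => /predU1P[/esym/uC -> | ].
    by apply: (subvP (addvSl _ _)); apply: memv_line.
  by move=> kE; apply: (subvP (addvSr _ _)); apply: Theta_Fil.
move/subvP/(_ x xF) => /memv_addP[_ /vlineP[c ->] [w wF ex]].
rewrite ex rpredD //; have [-> | c0] := eqVneq c 0; first by rewrite scale0r mem0v.
have [d d0] := Theta_sqr K C; rewrite kC => sq.
have := Theta_radical C xR; rewrite kC ex mulrDr rpredDr; last exact: Cw.
rewrite -scalerAr rpredZeq (negPf c0) /= => TT; apply: rpredZ.
have : d%:R *: Theta C \in Fil k.+1.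
  by rewrite -[_ *: _](subKr (Theta C * Theta C)) rpredB.
by rewrite rpredZeq (negPf (natr_neq0 d0)).
Qed.

Lemma radical_Fil1 x : x \in R -> x \in Fil 1.
Proof.
move=> xR; apply: (@radical_Fil_unique 0 set0) => //; last exact: radical_sub.
- by move=> E /eqP; rewrite cards_eq0 => /eqP.
- exact: cards0.
move=> w wF; suff : (Fil 1 <= amull (Theta set0) @^-1: Fil 1)%VS.
  by move/subvP/(_ w wF); rewrite -memv_preim lfunE.
apply: Fil_subP => E E1; rewrite -memv_preim lfunE /=.
by apply: Theta_mul_Fil1; rewrite -card_gt0.
Qed.

Lemma radical_FilN x : x \in R -> x \in Fil N -> x = 0.
Proof.
move=> xR xF; apply/eqP; rewrite -memv0 -(Fil_gtN K (ltnSn N)).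
apply: (@radical_Fil_unique N setT) => //; last 2 first.
- by rewrite cardsT card_ord.
- by move=> w; rewrite (Fil_gtN K (ltnSn N)) memv0 => /eqP->; rewrite mulr0 mem0v.
move=> E EN; apply/eqP; rewrite eqEcard subsetT cardsT card_ord EN /=.
exact: leqnn.
Qed.

Let two : 2%:R != 0 :> K := natr_neq0 (isT : (0 < 2)%N).

(** Each further factor gains one step, and [Fil_parity] gives another: after the multiplication if
    [N] is odd, before it if [N] is even. *)
Lemma radical_expv_Fil j : (R ^+ j.+1 <= Fil j.*2.+1)%VS.
Proof.
elim: j => [|j IH]; first by rewrite expv1; apply/subvP => x /radical_Fil1.
rewrite expvSr; apply/prodvP => y x /(subvP IH) yF xR.
have := Fil_radical xR yF; rewrite doubleS.
case: (boolP (odd N)) => oN.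
  by rewrite (@Fil_parity K N j.*2.+2) //= oddD oN /= negbK odd_double.
rewrite (@Fil_parity K N j.*2.+1) // in yF; last by rewrite oddD (negPf oN) /= odd_double.
by move=> _; apply: Fil_radical yF.
Qed.

(** The power lies in [Fil N], for even [N] by one more use of [Fil_parity], and in the radical,
    which meets [Fil N] trivially. *)
Lemma radical_expv0 : (0 < N)%N -> (R ^+ N.+1./2 = 0)%VS.
Proof.
move=> N0; apply/eqP; rewrite -subv0; apply/subvP => x xR; rewrite memv0; apply/eqP.
have eN : N.+1./2 = (N.-1)./2.+1 by rewrite -{1}(prednK N0).
apply: radical_FilN.
  move: x xR; apply/subvP; rewrite eN; elim: (_./2) => [|j IH]; first by rewrite expv1.
  rewrite expvSl; apply/prodvP => y z yR /(subvP IH) zR.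
  exact: (radical_mull Fil0_mul (radical_sub yR) zR).
rewrite eN in xR; have := subvP (radical_expv_Fil _) _ xR.
case: (boolP (odd N)) => oN.
  have -> // : (N.-1)./2.*2.+1 = N.
  by have := odd_double_half N.-1; case: N N0 oN => //= n _ /negPf ->; rewrite add0n => ->.
rewrite (@Fil_parity K N _) //; last by rewrite oddD (negPf oN) /= odd_double.
have -> // : (N.-1)./2.*2.+2 = N.
by have := odd_double_half N.-1; case: N N0 oN => //= n _; rewrite negbK => ->;
  rewrite add1n => ->.
Qed.

End RadicalFiltration.

(** * The action of sorting sums on polynomials *)

Section PolyAction.
Local Open Scope ring_scope.
Variables (K : fieldType) (N : nat).
Local Notation I := 'I_N.+1.
Local Notation KS := (group_algebra K 'S_N.+1).
Implicit Types (s t : 'S_N.+1) (x y : KS) (p q : {poly K}).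

(* ['X^i] stands for the word of length [N.+1] in two letters in which the
   second letter occurs once, at position [i]. *)
Definition perm_act s q : {poly K} := \sum_(i : I) q`_i *: 'X^((s^-1)%g i).

Definition pact x q : {poly K} := \sum_s x s *: perm_act s q.

Lemma perm_act_linear s : linear (perm_act s).
Proof.
move=> c p q; rewrite /perm_act scaler_sumr -big_split /=; apply: eq_bigr => i _.
by rewrite coefD coefZ scalerDl scalerA.
Qed.

Lemma pact_linear x : linear (pact x).
Proof.
move=> c p q; rewrite /pact scaler_sumr -big_split /=; apply: eq_bigr => s _.
by rewrite perm_act_linear scalerDr !scalerA mulrC.
Qed.

HB.instance Definition _ s := GRing.isLinear.Build K {poly K} {poly K} _ (perm_act s)
  (perm_act_linear s).
HB.instance Definition _ x := GRing.isLinear.Build K {poly K} {poly K} _ (pact x)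
  (pact_linear x).

Lemma perm_actX s (i : I) : perm_act s 'X^i = 'X^((s^-1)%g i).
Proof.
rewrite /perm_act (bigD1 i) //= coefXn eqxx scale1r big1 ?addr0 // => j ji.
by rewrite coefXn (inj_eq val_inj) (negPf ji) scale0r.
Qed.

Lemma perm_actM s t q : perm_act (s * t)%g q = perm_act s (perm_act t q).
Proof.
rewrite {3}/perm_act linear_sum /=; apply: eq_bigr => i _.
by rewrite linearZ /= perm_actX invMg permM.
Qed.

Lemma pactDl x y q : pact (x + y) q = pact x q + pact y q.
Proof.
rewrite /pact -big_split /=; apply: eq_bigr => s _.
by rewrite ffunE scalerDl.
Qed.

Lemma pactZl c x q : pact (c *: x) q = c *: pact x q.
Proof.
rewrite /pact scaler_sumr; apply: eq_bigr => s _.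
by rewrite ffunE scalerA.
Qed.

Lemma pact_suml (T : finType) (F : T -> KS) q : pact (\sum_i F i) q = \sum_i pact (F i) q.
Proof.
apply: (big_morph (pact^~ q)) => [x y |]; first exact: pactDl.
by rewrite -(scale0r 0) pactZl scale0r.
Qed.

Lemma pact_delta s q : pact (ga_delta K s) q = perm_act s q.
Proof.
rewrite /pact (bigD1 s) //= ffunE eqxx scale1r big1 ?addr0 // => t ts.
by rewrite ffunE (negPf ts) scale0r.
Qed.

Lemma ga_sum_delta x : x = \sum_s x s *: ga_delta K s.
Proof.
apply/ffunP => t; rewrite sum_ffunE (bigD1 t) //= !ffunE eqxx big1 ?addr0.
  by rewrite /GRing.scale /= mulr1.
by move=> s st; rewrite !ffunE eq_sym (negPf st) scaler0.
Qed.

Lemma pactM x y q : pact (x * y) q = pact x (pact y q).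
Proof.
rewrite {1}[x]ga_sum_delta mulr_suml pact_suml {2}/pact; apply: eq_bigr => s _.
rewrite -scalerAl pactZl; congr (_ *: _).
rewrite {1}[y]ga_sum_delta mulr_sumr pact_suml {2}/pact linear_sum /=.
apply: eq_bigr => t _; rewrite -scalerAr pactZl linearZ /= ga_deltaM.
by rewrite pact_delta perm_actM.
Qed.

Section SortAction.
Variables (B : finType) (bk : B -> nat) (u : B -> K).
Hypothesis bk_inj : injective bk.
Local Notation label_key := (label_key bk).
Local Notation Y := ('X - 1 : {poly K}).

Definition weight (g : {ffun I -> B}) : K := \prod_a u (g a).

Lemma weight_inv : perm_invariant weight.
Proof.
move=> s g; rewrite /weight [RHS](reindex_inj (@perm_inj _ s)) /=.
by apply: eq_bigr => a _; rewrite ffunE.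
Qed.

Lemma sortsum_weight_Fil : sortsum bk weight \in Fil K N 0.
Proof.
rewrite (sortsumE bk_inj weight_inv); apply: rpred_sum => g _.
by rewrite rpredZ // Theta_Fil.
Qed.

Definition total_weight : K := 2%:R * \sum_b u b.
(** The coefficient of ['X - 1] in [step l (~~ l.2)], for either sign of a label [l] of block
    [b]. *)
Definition label_center b : K := 2%:R * (\sum_(c | (bk c < bk b)%N) u c) + u b.

(* [step l c] is the total weight of the labels of a letter, marked by ['X] if
   it precedes a letter of label [l], labels equal to [l] being marked iff [c]. *)
Let step (l : B * bool) (c : bool) : {poly K} :=
  \sum_(m : B * bool) (u m.1) *: 'X^((label_key m < label_key l)%N || (m == l) && c).

(** Fix the label [l] of letter [i]. The exponent of the image is the number of letters preceding
    it, so each other letter contributes a factor independently; ties with [l] precede it among the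
    earlier letters if [l] is positive, among the later ones if it is negative. *)
Lemma pact_sortsum_Xn (i : nat) : (i <= N)%N ->
  pact (sortsum bk weight) 'X^i =
  \sum_(l : B * bool) u l.1 *: (step l l.2 ^+ i * step l (~~ l.2) ^+ (N - i)).
Proof.
move=> iN; have iI : (i < N.+1)%N by [].
pose p : I := Ordinal iI.
rewrite /sortsum pact_suml.
rewrite (partition_big (fun h : {ffun I -> B * bool} => h p) predT) //=; apply: eq_bigr => l _.
pose G (b : I) (m : B * bool) : {poly K} := u m.1 *: (if b == p then 1 else
  'X^((label_key m < label_key l)%N || (m == l) && (if l.2 then (b < p)%N else (p < b)%N))).
transitivity (\sum_(h in family (fun b m => (b == p) ==> (m == l))) \prod_b G b (h b)).
  apply: eq_big => [h | h /eqP hp].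
    apply/eqP/familyP => [hp b | /(_ p)]; last by rewrite -topredE /= eqxx => /eqP.
    by rewrite -topredE /=; case: eqP => // ->; rewrite hp eqxx.
  rewrite pactZl pact_delta -[i]/(val p) perm_actX invgK val_rho /rank -sum1_card.
  rewrite (eq_bigl (fun b => prec (fun a => label_key (h a)) b p)); last by move=> b;
    rewrite inE.
  rewrite scaler_prod; congr (_ *: _).
    by apply: eq_bigr => b _; rewrite ffunE.
  rewrite big_mkcond expr_sum; apply: eq_bigr => b _.
  case: eqVneq => [-> | bp]; first by rewrite prec_irr expr0.
  rewrite /prec hp (inj_eq (key_inj bk_inj)); case: eqVneq => [-> | ne]; last first.
    by rewrite !orbF; case: ifP.
  rewrite ltnn /= /label_key oddD odd_double oddb /=; by case: ifP => //; case: ifP.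
rewrite -bigA_distr_big_dep (bigD1 p) //= eqxx /= big_pred1_eq /G eqxx.
rewrite -[X in X * _]/(_ *: 1) -scalerAl mul1r; congr (_ *: _).
have card_above : #|[set b : I | p < b]%N| = (N - p)%N.
  have := cardsC [set b : I | p < b]%N; rewrite card_ord.
  have -> : ~: [set b : I | p < b]%N = p |: [set b : I | b < p]%N.
    by apply/setP => b; rewrite !inE -val_eqE -leqNgt /=; case: ltngtP.
  by rewrite cardsU1 inE ltnn card_ord_below /=; lia.
have stepE (b : I) (c : bool) : b != p -> c = (if l.2 then (b < p)%N else (p < b)%N) ->
    \sum_(m | (b == p) ==> (m == l)) G b m = step l c.
  by move=> /negPf bp ->; apply: eq_big => m; rewrite ?bp // /G bp.
rewrite (bigID (fun b : I => (b < p)%N)) /=; congr (_ * _).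
  transitivity (\prod_(b in [set b : I | b < p]%N) step l l.2); last first.
    by rewrite prodr_const card_ord_below.
  apply: eq_big => b.
    by rewrite inE -val_eqE; case: ltngtP.
  by case/andP=> bp lt; apply: stepE => //; rewrite lt ltnNge (ltnW lt); case: (l.2).
transitivity (\prod_(b in [set b : I | p < b]%N) step l (~~ l.2)); last first.
  by rewrite prodr_const card_above.
apply: eq_big => b.
  by rewrite inE -val_eqE; case: ltngtP.
case/andP=> bp ge; apply: stepE => //; have lt : (p < b)%N.
  by rewrite ltn_neqAle eq_sym bp leqNgt.
by rewrite lt (negPf ge); case: (l.2).
Qed.

(** With ['X = 1 + Y], the coefficient of [Y] is the weight of the marked labels; smaller blocks
    count twice, once for each sign. *)
Let stepE l c : step l c =
  total_weight%:P + (2%:R * (\sum_(d | (bk d < bk l.1)%N) u d) + u l.1 * (l.2%:R + c%:R)) *: Y.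
Proof.
case: l => b s; pose e m := (label_key m < label_key (b, s))%N || (m == (b, s)) && c.
have -> : step (b, s) c = (\sum_(m : B * bool) u m.1)%:P + (\sum_(m : B * bool) u m.1 * (e
  m)%:R) *: Y.
  rewrite raddf_sum scaler_suml -big_split; apply: eq_bigr => m _ /=.
  rewrite /step -/(e m) -[(u m.1)%:P]alg_polyC -scalerA -scalerDr; congr (_ *: _).
  by case: (e m); rewrite ?expr1 ?expr0 ?scale1r ?scale0r ?addr0 // addrC subrK.
congr (_%:P + _ *: _).
  transitivity (\sum_d \sum_(t : bool) u d); first by rewrite pair_bigA.
  by rewrite /total_weight mulr_sumr; apply: eq_bigr => d _;
    rewrite big_bool /= mulr_natl mulr2n.
transitivity (\sum_d \sum_(t : bool) u d * (e (d, t))%:R).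
  by rewrite pair_bigA; apply: eq_bigr => -[d t] _.
rewrite (bigD1 b) //= addrC (bigID (fun d => bk d < bk b)%N) /= [X in _ + X + _]big1 ?addr0.
  congr (_ + _).
    rewrite mulr_sumr; apply: eq_big => [d | d /andP[db lt]].
      by case: eqVneq => //= ->; rewrite ltnn.
    have kt (t : bool) : (label_key (d, t) < label_key (b, s))%N.
      by rewrite /label_key /=; case: t; case: s @e; lia.
    by rewrite big_bool /= /e !kt /=; ring.
  rewrite big_bool /= /e /label_key /= !xpair_eqE eqxx ltn_add2l /=.
  by case: s @e; case: c => _ /=; rewrite ?ltnn ?ltnSn ?ltn_add2l /=; ring.
move=> d /andP[db ge]; apply: big1 => t _; have : (bk b < bk d)%N.
  by move: ge; rewrite -leqNgt leq_eqVlt => /predU1P[/bk_inj e'|//]; rewrite e' eqxx in db.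
move=> lt; rewrite /e xpair_eqE (negPf db) /= orbF.
have -> : (label_key (d, t) < label_key (b, s))%N = false.
  by rewrite /label_key /=; case: t; case: s @e; lia.
by rewrite mulr0.
Qed.

(** The binomial expansion of [Y ^+ j] collapses to a power of [step l l.2 - step l (~~ l.2)], which
    is [u b *: Y] up to the sign of [l]; for odd [j] the two signs cancel. *)
Lemma pact_sortsum (j : nat) : (j <= N)%N ->
  pact (sortsum bk weight) (Y ^+ j) =
  (1 + (-1) ^+ j) *: \sum_b (u b ^+ j.+1) *: (Y ^+ j * (total_weight%:P + label_center b *:
    Y) ^+ (N - j)).
Proof.
move=> jN; transitivity (\sum_(l : B * bool) u l.1 *:
    ((step l l.2 - step l (~~ l.2)) ^+ j * step l (~~ l.2) ^+ (N - j))).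
  rewrite {1}exprBn linear_sum /=.
  under eq_bigr => i _.
    rewrite expr1n mulr1 linearMn /= -signr_odd mulr_sign.
    have iN : (j - i <= N)%N by lia.
    rewrite (_ : pact _ _ = (-1) ^+ i *: (\sum_(l : B * bool) u l.1 *:
       (step l l.2 ^+ (j - i) * step l (~~ l.2) ^+ (N - (j - i))))); last first.
      rewrite -pact_sortsum_Xn // -linearZ /=; congr pact.
      by rewrite -signr_odd; case: (odd i); rewrite ?expr0 ?expr1 ?scale1r ?scaleN1r.
    rewrite scaler_sumr -sumrMnl.
    over.
  rewrite exchange_big /=; apply: eq_bigr => l _.
  rewrite exprBn mulr_suml scaler_sumr; apply: eq_bigr => i _.
  rewrite mulrnAl -!scalerMnr; congr (_ *+ _).
  have -> : (N - (j - i) = i + (N - j))%N by have := ltn_ord i; lia.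
  rewrite exprD scalerA mulrC -scalerA; congr (_ *: _).
  by rewrite -!mulrA -[in LHS]signr_odd scaler_sign -[in RHS]signr_odd mulr_sign.
transitivity (\sum_b \sum_(s : bool) u b *: ((step (b, s) s - step (b, s) (~~ s)) ^+ j *
    step (b, s) (~~ s) ^+ (N - j))).
  by rewrite pair_bigA; apply: eq_bigr => -[b s] _.
rewrite scaler_sumr; apply: eq_bigr => b _; rewrite big_bool /= !stepE /=.
have e1 : 2%:R * (\sum_(d | (bk d < bk b)%N) u d) + u b * (1%:R + 0%:R) = label_center b.
  by rewrite /label_center addr0 mulr1.
have e2 : 2%:R * (\sum_(d | (bk d < bk b)%N) u d) + u b * (1%:R + 1%:R) = label_center b + u b.
  by rewrite /label_center; ring.
have e3 : 2%:R * (\sum_(d | (bk d < bk b)%N) u d) + u b * (0%:R + 1%:R) = label_center b.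
  by rewrite /label_center add0r mulr1.
have e4 : 2%:R * (\sum_(d | (bk d < bk b)%N) u d) + u b * (0%:R + 0%:R) = label_center b - u b.
  by rewrite /label_center; ring.
rewrite e1 e2 e3 e4.
have dif c : total_weight%:P + (label_center b + c) *: Y - (total_weight%:P + label_center
  b *: Y) = c *: Y.
  by rewrite opprD addrACA subrr add0r scalerDl addrAC subrr add0r.
rewrite !dif !exprZn -!scalerAl !scalerA -scalerDl; congr (_ *: _).
by rewrite [(- u b) ^+ j]exprNn exprS; ring.
Qed.
End SortAction.
End PolyAction.

(** * Radical elements from commutators, and coordinates in powers of ['X - 1] *)

Section LowerBound.
Local Open Scope ring_scope.
Variables (K : fieldType) (N : nat).
Local Notation I := 'I_N.+1.
Local Notation KS := (group_algebra K 'S_N.+1).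
Local Notation Fil := (Fil K N).
Local Notation Y := ('X - 1 : {poly K}).
Implicit Types (x y : KS) (q : {poly K}) (v : nat -> K).

(** Modulo more cuts, [x] and [y] act on each [Theta C] by scalars, which commute. *)
Lemma Fil_commutator k x y z : x \in Fil 0 -> y \in Fil 0 ->
  z \in Fil k -> z * (x * y - y * x) \in Fil k.+1.
Proof.
move=> x0 y0 zk; suff : (Fil k <= amulr (x * y - y * x) @^-1: Fil k.+1)%VS.
  by move/subvP/(_ z zk); rewrite -memv_preim lfunE.
apply: Fil_subP => C kC; rewrite -memv_preim lfunE /=.
apply: (subvP (Fil_le K N (_ : k.+1 <= #|C|.+1)%N)) => //.
have ex u : u \in Fil 0 -> exists c, exists2 X, X \in Fil #|C|.+1 &
    Theta K C * u = X + c *: Theta K C.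
  by case/(Theta_mul C) => c uF; exists c, (Theta K C * u - c *: Theta K C); rewrite ?subrK.
have [c [X XF xE]] := ex x x0; have [d [Z ZF yE]] := ex y y0.
rewrite mulrBr !mulrA xE yE !mulrDl -!scalerAl xE yE !scalerDr !scalerA [d * c]mulrC.
rewrite !addrA opprD addrACA subrr addr0.
by rewrite rpredB ?rpredD ?rpredZ ?Fil_mulr.
Qed.

Lemma commutator_mul_radical x y z : x \in Fil 0 -> y \in Fil 0 -> z \in Fil 0 ->
  (x * y - y * x) * z \in radical (Fil 0).
Proof.
move=> x0 y0 z0; set w := _ - _.
have w0 : w \in Fil 0 by rewrite rpredB // Fil_mulr.
apply: nilpotent_mul_radical => //; first exact: Fil0_mul.
(* Each factor [u = c w + a w] ends in the commutator [w], so all factors but the first raise the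
   filtration, and [Fil N.+1] is zero. *)
move=> c a a0; exists N.+2; set u := _ + _.
have u0 : u \in Fil 0 by rewrite rpredD ?rpredZ ?Fil_mulr.
suff uk k : u ^+ k.+1 \in Fil k.
  by apply/eqP; rewrite -memv0 -(Fil_gtN K (ltnSn N)).
elim: k => [|k IH]; first by rewrite expr1.
rewrite exprSr mulrDr -scalerAr mulrA rpredD ?rpredZ ?Fil_commutator //.
by rewrite Fil_mulr.
Qed.

(** The coefficient of [('X - 1) ^+ i] in [q], read off after shifting the variable. *)
Definition ycoord q (i : nat) : K := (q \Po ('X + 1))`_i.

Lemma Y_comp : Y \Po ('X + 1) = 'X.
Proof. by rewrite comp_polyB comp_polyX comp_polyC addrK. Qed.

Lemma coef_binomial (t c : K) (e i : nat) :
  ((t%:P + c *: 'X) ^+ e)`_i = t ^+ (e - i) * c ^+ i *+ 'C(e, i).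
Proof.
rewrite exprDn coef_sum; have [ie | ie] := ltnP i e.+1; last first.
  rewrite bin_small // mulr0n big1 // => j _; rewrite coefMn exprZn -scalerAr coefZ.
  rewrite -polyC_exp coefCM coefXn; case: eqVneq => [e' | ]; rewrite ?mulr0 ?mul0rn //.
  by have := ltn_ord j; lia.
rewrite (bigD1 (Ordinal ie)) //= big1 ?addr0 => [|j ji];
  rewrite coefMn exprZn -polyC_exp coefCM coefZ coefXn.
  by rewrite eqxx mulr1.
by move: ji; rewrite -val_eqE /= eq_sym => /negPf ->; rewrite !mulr0 mul0rn.
Qed.

Lemma coord_binomial (t c : K) (j e i : nat) : (j <= i)%N ->
  ycoord (Y ^+ j * (t%:P + c *: Y) ^+ e) i = t ^+ (e - (i - j)) * c ^+ (i - j) *+ 'C(e, i - j).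
Proof.
move=> ji; rewrite /ycoord comp_polyM !rmorphXn /= Y_comp comp_polyD comp_polyZ Y_comp
  comp_polyC.
by rewrite coefXnM ltnNge ji /= coef_binomial.
Qed.

Lemma coord_binomial_lt (t c : K) (j e i : nat) : (i < j)%N ->
  ycoord (Y ^+ j * (t%:P + c *: Y) ^+ e) i = 0.
Proof.
by move=> ij; rewrite /ycoord comp_polyM !rmorphXn /= Y_comp coefXnM ij.
Qed.

Lemma coordD p q i : ycoord (p + q) i = ycoord p i + ycoord q i.
Proof. by rewrite /ycoord comp_polyD coefD. Qed.

Lemma coordZ c q i : ycoord (c *: q) i = c * ycoord q i.
Proof. by rewrite /ycoord linearZ /= coefZ. Qed.

Lemma coord_sum (T : finType) (F : T -> {poly K}) i :
  ycoord (\sum_k F k) i = \sum_k ycoord (F k) i.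
Proof. by rewrite /ycoord linear_sum coef_sum. Qed.

Lemma coord_expand q : (size q <= N.+1)%N -> q = \sum_(j : I) ycoord q j *: Y ^+ j.
Proof.
move=> sq; pose p := q \Po ('X + 1).
have sX : size ('X + 1 : {poly K}) = 2%N by rewrite size_XaddC.
have sp : (size p <= N.+1)%N by rewrite size_comp_poly2.
have -> : q = p \Po Y by rewrite -comp_polyA comp_polyD comp_polyX comp_polyC subrK comp_polyXr.
rewrite {1}(_ : p = \sum_(j : I) p`_j *: 'X^j).
  rewrite linear_sum; apply: eq_bigr => j _; rewrite linearZ /= rmorphXn /= comp_polyX.
  by rewrite /ycoord -comp_polyA Y_comp comp_polyXr.
rewrite -poly_def; apply/polyP => i; rewrite coef_poly; case: ltnP => // Ni.
by rewrite nth_default // (leq_trans sp).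
Qed.

Lemma size_pact x q : (size (pact x q) <= N.+1)%N.
Proof.
rewrite /pact; apply: (big_ind (fun p : {poly K} => size p <= N.+1)%N).
- by rewrite size_poly0.
- by move=> p r sp sr; rewrite (leq_trans (size_polyD _ _)) // geq_max sp.
move=> s _; apply: leq_trans (size_scale_leq _ _) _.
apply: (big_ind (fun p : {poly K} => size p <= N.+1)%N).
- by rewrite size_poly0.
- by move=> p r sp sr; rewrite (leq_trans (size_polyD _ _)) // geq_max sp.
by move=> i _; apply: leq_trans (size_scale_leq _ _) _; rewrite size_polyXn ltn_ord.
Qed.

Lemma coord_pact x q i : (size q <= N.+1)%N ->
  ycoord (pact x q) i = \sum_(j : I) ycoord q j * ycoord (pact x (Y ^+ j)) i.
Proof.
move=> sq; rewrite {1}(coord_expand sq) linear_sum coord_sum.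
by apply: eq_bigr => j _; rewrite linearZ /= coordZ.
Qed.
End LowerBound.

(** * Lower bound: a radical element with a large nonzero power *)

Section Witness.
Local Open Scope ring_scope.
Variables (K : fieldType) (N : nat).
Local Notation I := 'I_N.+1.
Local Notation KS := (group_algebra K 'S_N.+1).
Local Notation Fil := (Fil K N).
Local Notation Y := ('X - 1 : {poly K}).
Implicit Types (x y : KS) (q : {poly K}).
Hypothesis charK0 : [pchar K] =i pred0.

Let natr_neq0 n : (0 < n)%N -> n%:R != 0 :> K.
Proof. by move=> n0; rewrite ((pcharf0P K).1 charK0) -lt0n. Qed.

Definition one_block : KS := sortsum (@nat_of_ord 1) (weight (fun _ => 1)).
Definition two_block : KS :=
  sortsum nat_of_bool (weight (fun c : bool => if c then 2%:R else 1)).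

Lemma one_block_Fil : one_block \in Fil 0.
Proof. exact: sortsum_weight_Fil val_inj. Qed.

Lemma two_block_Fil : two_block \in Fil 0.
Proof. by apply: sortsum_weight_Fil => -[] []. Qed.

Lemma coord_one_block i j : (i <= N)%N -> (j <= N)%N ->
  ycoord (pact one_block (Y ^+ j)) i =
  if odd j || (i < j)%N then 0 else 2%:R * 2%:R ^+ (N - i) *+ 'C(N - j, i - j).
Proof.
move=> iN jN; rewrite pact_sortsum //; last exact: val_inj.
rewrite coordZ -signr_odd; case: (odd j) => /=; first by rewrite expr1 subrr mul0r.
rewrite coord_sum big_ord1 coordZ expr1n mul1r; case: ltnP => ij.
  by rewrite coord_binomial_lt ?mulr0.
rewrite coord_binomial // /total_weight /label_center big_ord1 big_pred0 => [|d];
  last by rewrite [d]ord1 ltnn.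
rewrite mulr0 add0r !expr1n !mulr1 expr0 mulrnAr.
by have -> : (N - j - (i - j) = N - i)%N by lia.
Qed.

Lemma coord_two_block i j : (i <= N)%N -> (j <= N)%N ->
  ycoord (pact two_block (Y ^+ j)) i =
  if odd j || (i < j)%N then 0 else
    2%:R * 6%:R ^+ (N - i) * (1 + 2%:R ^+ j.+1 * 4%:R ^+ (i - j)) *+ 'C(N - j, i - j).
Proof.
move=> iN jN; rewrite pact_sortsum //; last by case=> [] [].
rewrite coordZ -signr_odd; case: (odd j) => /=; first by rewrite expr1 subrr mul0r.
rewrite coord_sum big_bool !coordZ /= expr1n mul1r; case: ltnP => ij.
  by rewrite !coord_binomial_lt // mulr0 addr0 mulr0.
set u := fun c : bool => _.
(* The total weight is [2 * (1 + 2)]; the centers are [1] and [2 * 1 + 2]. *)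
have -> : total_weight u = 6%:R by rewrite /total_weight big_bool /u /=; ring.
have -> : label_center nat_of_bool u true = 4%:R.
  by rewrite /label_center (big_pred1 false) /u /=; [ring | case].
have -> : label_center nat_of_bool u false = 1.
  by rewrite /label_center big_pred0 /u /=; [ring | case].
rewrite !coord_binomial //; have -> : (N - j - (i - j) = N - i)%N by lia.
have [c cE] : exists c : K, forall x : K, x *+ 'C(N - j, i - j) = x * c.
  by exists 'C(N - j, i - j)%:R => x; rewrite mulr_natr.
rewrite expr0 expr1n !cE.
by move: (6%:R ^+ _) (4%:R ^+ _) (2%:R ^+ _) => p s k; ring.
Qed.

(** Odd coordinates stay arbitrary: [one_block] and [two_block] kill the odd basis vectors. *)
Definition even_below t q := (size q <= N.+1)%N /\
  forall i, (i < t)%N -> ~~ odd i -> ycoord q i = 0.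

Section Step.
Variables (x : KS) (M : nat -> nat -> K).
Hypothesis xM : forall i j, (i <= N)%N -> (j <= N)%N ->
  ycoord (pact x (Y ^+ j)) i = if odd j || (i < j)%N then 0 else M i j.

Lemma coord_pact_supp q i t : (size q <= N.+1)%N -> even_below t q -> (i <= N)%N ->
  ycoord (pact x q) i = \sum_(j : I | (t <= j <= i)%N && ~~ odd j) ycoord q j * M i j.
Proof.
move=> sq [_ qt] iN; rewrite coord_pact // [RHS]big_mkcond; apply: eq_bigr => j _.
rewrite xM //; last exact: (ltn_ord j).
case: ifP => [/orP[oj | ij] | /norP[oj ij]].
- by rewrite oj andbF mulr0.
- by rewrite [(j <= i)%N]leqNgt ij andbF mulr0.
case: ifP => //; rewrite [(j <= i)%N]leqNgt ij oj !andbT => /negbT; rewrite -ltnNge => tj.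
by rewrite qt ?mul0r.
Qed.

Variables (t : nat) (q : {poly K}).
Hypotheses (et : ~~ odd t) (qt : even_below t q).

Lemma even_below_pact : even_below t (pact x q).
Proof.
split=> [|i it oi]; first exact: size_pact.
have [iN | Ni] := leqP i N; last first.
  by rewrite /ycoord nth_default // size_comp_poly2 ?size_XaddC // (leq_trans (size_pact _ _)).
rewrite (coord_pact_supp qt.1 qt iN) big1 // => j /andP[/andP[tj ji] _].
by move: (leq_trans tj ji); rewrite leqNgt it.
Qed.

Lemma coord_pact0 : (t <= N)%N -> ycoord (pact x q) t = M t t * ycoord q t.
Proof.
move=> tN; rewrite (coord_pact_supp qt.1 qt tN) (big_pred1 (Ordinal (tN : t < N.+1)%N)) /=.
  by rewrite mulrC.
by move=> j /=; rewrite -eqn_leq -[RHS]val_eqE /= eq_sym; case: eqVneq => //= ->.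
Qed.

Lemma coord_pact1 : (t.+1 <= N)%N -> ycoord (pact x q) t.+1 = M t.+1 t * ycoord q t.
Proof.
move=> tN; rewrite (coord_pact_supp qt.1 qt tN) (big_pred1 (Ordinal (ltnW tN : t < N.+1)%N)) /=.
  by rewrite mulrC.
move=> j /=; rewrite -val_eqE /=; apply/idP/eqP => [/andP[/andP[tj jt] oj] | ->];
  last by rewrite leqnn leqnSn.
by move: jt; rewrite leq_eqVlt => /predU1P[ej | ]; [move: oj; rewrite ej /= et | lia].
Qed.

Lemma coord_pact2 : (t.+2 <= N)%N ->
  ycoord (pact x q) t.+2 = M t.+2 t * ycoord q t + M t.+2 t.+2 * ycoord q t.+2.
Proof.
move=> tN; have tN' : (t < N.+1)%N by lia.
rewrite (coord_pact_supp qt.1 qt tN) (bigD1 (Ordinal tN')) /=;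
  last by rewrite leqnn et andbT /=; lia.
rewrite (big_pred1 (Ordinal (tN : t.+2 < N.+1)%N)) /=; first by rewrite ![ycoord _ _ * _]mulrC.
move=> j /=; rewrite -!val_eqE /=; apply/idP/eqP => [ | ->];
  last by rewrite negbK et leqnn /=; lia.
move=> /andP[/andP[/andP[tj jt] oj]] nt.
move: jt; rewrite leq_eqVlt => /predU1P[// | ]; rewrite ltnS leq_eqVlt => /predU1P[ej|];
  last lia.
by move: oj; rewrite ej /= et.
Qed.
End Step.

Let MA (i j : nat) : K := 2%:R * 2%:R ^+ (N - i) *+ 'C(N - j, i - j).
Let MB (i j : nat) : K :=
  2%:R * 6%:R ^+ (N - i) * (1 + 2%:R ^+ j.+1 * 4%:R ^+ (i - j)) *+ 'C(N - j, i - j).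
Let aM : forall i j, (i <= N)%N -> (j <= N)%N ->
  ycoord (pact one_block (Y ^+ j)) i = if odd j || (i < j)%N then 0 else MA i j.
Proof. exact: coord_one_block. Qed.
Let bM : forall i j, (i <= N)%N -> (j <= N)%N ->
  ycoord (pact two_block (Y ^+ j)) i = if odd j || (i < j)%N then 0 else MB i j.
Proof. exact: coord_two_block. Qed.

Definition witness : KS :=
  (one_block * two_block - two_block * one_block) * one_block.

Lemma pact_witness q : pact witness q =
  pact one_block (pact two_block (pact one_block q))
  - pact two_block (pact one_block (pact one_block q)).
Proof. by rewrite /witness pactM -scaleN1r pactDl pactZl scaleN1r !pactM. Qed.

Lemma ycoordB p q i : ycoord (p - q) i = ycoord p i - ycoord q i.
Proof. by rewrite -scaleN1r coordD coordZ mulN1r. Qed.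

Lemma pow2_sub2_neq0 (t : nat) : (2 <= t)%N -> 2%:R ^+ t.+1 - 2%:R != 0 :> K.
Proof.
move=> t2; have t4 : (2 < 2 ^ t.+1)%N.
  by apply: leq_trans (_ : 2 ^ 2 <= _)%N; rewrite // leq_pexp2l // ltnW.
by rewrite -natrX -natrB ?natr_neq0 ?subn_gt0 // ltnW.
Qed.

(** Diagonal entries cancel in the commutator, so the coordinate at [t] disappears and the one at
    [t + 2] leads among the even ones. *)
Lemma witness_step t q : ~~ odd t -> (2 <= t)%N -> (t.+2 <= N)%N ->
    even_below t q -> ycoord q t != 0 ->
  even_below t.+2 (pact witness q) /\ ycoord (pact witness q) t.+2 != 0.
Proof.
move=> et t2 tN qt q0; have tN' : (t <= N)%N by lia.
have q1t := even_below_pact aM qt.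
have [aq1 bq1] := (even_below_pact aM q1t, even_below_pact bM q1t).
split; last first.
  rewrite pact_witness ycoordB (coord_pact2 aM et bq1) // (coord_pact2 bM et aq1) //.
  rewrite (coord_pact2 bM et q1t) // (coord_pact2 aM et q1t) // (coord_pact0 bM et q1t) //
    (coord_pact0 aM et q1t) //.
  (* The coordinate [z] enters both products with the same diagonal factor and cancels. *)
  rewrite (coord_pact0 aM et qt) //; move: (ycoord (pact one_block q) t.+2) => z.
  have [e eN] : exists e, N = (t + e.+2)%N by exists (N - t.+2)%N; lia.
  rewrite /MA /MB !subnn !bin0 !mulr1n.
  have -> : (t.+2 - t = 2)%N by lia.
  have -> : (N - t = e.+2)%N by lia.
  have -> : (N - t.+2 = e)%N by lia.
  have [c c0 cE] : exists2 c : K, c != 0 & forall x : K, x *+ 'C(e.+2, 2) = x * c.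
    by exists 'C(e.+2, 2)%:R => [|x]; rewrite ?natr_neq0 ?bin_gt0 ?mulr_natr.
  rewrite !cE !expr0 !mulr1; have := pow2_sub2_neq0 t2.
  have -> : 2%:R ^+ t.+3 = 4%:R * 2%:R ^+ t.+1 :> K by rewrite !exprS; ring.
  have -> : 2%:R ^+ e.+2 = 4%:R * 2%:R ^+ e :> K by rewrite !exprS; ring.
  have -> : 6%:R ^+ e.+2 = 36%:R * 6%:R ^+ e :> K by rewrite !exprS; ring.
  have p0 : 2%:R ^+ e != 0 :> K by rewrite expf_neq0 // natr_neq0.
  have s0 : 6%:R ^+ e != 0 :> K by rewrite expf_neq0 // natr_neq0.
  move: (2%:R ^+ e) (6%:R ^+ e) (2%:R ^+ t.+1) (ycoord q t) p0 s0 q0.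
  move=> p s k w p0 s0 w0 k0; set v := (X in X != 0).
  have -> : v = - (512%:R * c * p ^+ 2 * s * (k - 2%:R) * w) by rewrite /v; ring.
  by rewrite oppr_eq0 !mulf_neq0 ?expf_neq0 ?natr_neq0.
split=> [|i it oi]; first exact: size_pact.
rewrite pact_witness ycoordB; move: it; rewrite ltnS leq_eqVlt => /predU1P[ei | ].
  by move: oi; rewrite ei /= et.
rewrite ltnS leq_eqVlt => /predU1P[-> | it].
  rewrite (coord_pact0 aM et bq1) // (coord_pact0 bM et aq1) // (coord_pact0 bM et q1t) //
    (coord_pact0 aM et q1t) //.
  by rewrite mulrCA subrr.
by rewrite (even_below_pact aM bq1).2 // (even_below_pact bM aq1).2 // subrr.
Qed.

(** For odd [N] no coordinate [t + 2] is left, and the last factor is detected at the odd coordinate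
    [t + 1 = N]. *)
Lemma witness_last t q : ~~ odd t -> (2 <= t)%N -> N = t.+1 ->
  even_below t q -> ycoord q t != 0 -> ycoord (pact witness q) t.+1 != 0.
Proof.
move=> et t2 eN qt q0; have tN' : (t <= N)%N by lia.
have tN : (t.+1 <= N)%N by lia.
have q1t := even_below_pact aM qt.
have [aq1 bq1] := (even_below_pact aM q1t, even_below_pact bM q1t).
rewrite pact_witness ycoordB (coord_pact1 aM et bq1) // (coord_pact1 bM et aq1) //.
rewrite (coord_pact0 bM et q1t) // (coord_pact0 aM et q1t) // (coord_pact0 aM et qt) //.
have -> : MA t t = 4%:R by rewrite /MA subnn bin0 eN subSnn mulr1n expr1; ring.
have -> : MA t.+1 t = 2%:R by rewrite /MA eN subSnn subnn binn mulr1n expr0 mulr1.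
have -> : MB t t = 12%:R * (1 + 2%:R ^+ t.+1).
  by rewrite /MB subnn bin0 eN subSnn expr0 mulr1 mulr1n expr1; ring.
have -> : MB t.+1 t = 2%:R * (1 + 4%:R * 2%:R ^+ t.+1).
  by rewrite /MB eN subSnn subnn binn mulr1n expr0 expr1; ring.
move: (pow2_sub2_neq0 t2) q0; move: (2%:R ^+ t.+1) (ycoord q t) => k w k0 w0.
set v := (X in X != 0).
have -> : v = - (32%:R * (k - 2%:R) * w) by rewrite /v; ring.
by rewrite oppr_eq0 !mulf_neq0 ?natr_neq0.
Qed.

Lemma witness_iter k (q := iter k (pact witness) (Y ^+ 2)) : (k.*2.+2 <= N)%N ->
  even_below k.*2.+2 q /\ ycoord q k.*2.+2 != 0.
Proof.
have Y2 i : ycoord (Y ^+ 2) i = (i == 2%N)%:R by rewrite /ycoord rmorphXn /= Y_comp coefXn.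
rewrite {}/q; elim: k => [|k IH] kN.
  split=> /=; last by rewrite Y2 eqxx oner_neq0.
  by split=> [|i i2 _]; [rewrite size_exp_XsubC | rewrite Y2; case: eqP i2 => // ->].
have [qt q0] := IH (leq_trans (leq_addl 2 _) kN).
by rewrite doubleS; apply: witness_step => //=; rewrite odd_double.
Qed.

Lemma pactX x k q : pact (x ^+ k.+1) q = iter k.+1 (pact x) q.
Proof. by elim: k => [|k IH] //; rewrite exprS pactM IH. Qed.

(** From coordinate [2], the first [k] factors lead to [2 k + 2]. The last factor reaches coordinate
    [N], by [witness_last] if [N] is odd and by a further regular step if it is even. *)
Lemma witness_power_neq0 k : (k.+2 = N.+1./2)%N -> witness ^+ k.+1 != 0.
Proof.
move=> ek; have eN : (N = k.+1.*2.+1 \/ N = k.+1.*2.+2)%N.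
  by have := odd_double_half N.+1; rewrite -ek !doubleS; case: odd; lia.
suff : ycoord (pact (witness ^+ k.+1) (Y ^+ 2)) N != 0.
  apply: contraNneq => ->; rewrite -(scale0r 0) pactZl scale0r.
  by rewrite /ycoord comp_poly0 coef0.
rewrite pactX; case: eN => eN; last first.
  by rewrite {2}eN; apply: (witness_iter _).2; rewrite -eN.
have kN : (k.*2.+2 <= N)%N by rewrite eN doubleS.
have [qt q0] := witness_iter kN; rewrite [in X in ycoord _ X]eN.
by apply: witness_last; rewrite //= odd_double.
Qed.

Lemma witness_radical : witness \in radical (Fil 0).
Proof. exact: commutator_mul_radical one_block_Fil two_block_Fil one_block_Fil. Qed.

Lemma radical_expv_neq0 k : (0 < k < N.+1./2)%N -> (radical (Fil 0) ^+ k != 0)%VS.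
Proof.
case: k => // k /andP[_ kN]; apply/negP => /eqP R0.
have wR j : witness ^+ j.+1 \in (radical (Fil 0) ^+ j.+1)%VS.
  elim: j => [|j IH]; first exact: witness_radical.
  by rewrite exprS expvSl memv_mul ?witness_radical.
have := wR k; rewrite R0 memv0 => /eqP w0.
have [j ej] : exists j, (j.+2 = N.+1./2)%N by exists (N.+1./2 - 2)%N; lia.
case/negP: (witness_power_neq0 ej); have kj : (k.+1 <= j.+1)%N by lia.
by rewrite -(subnK kj) exprD w0 mulr0.
Qed.
End Witness.

Theorem theorem10p10 (K : fieldType) (charK0 : [pchar K]%R =i pred0)
    (n : nat) (n_gt1 : 1 < n) :
  nilpotency_index (radical (peak_algebra K n))
    (if odd n then (n - 1) %/ 2 else n %/ 2).
Proof.
case: n n_gt1 => // N N0; have two : (2%:R != 0 :> K)%R by rewrite ((pcharf0P K).1 charK0).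
(* In both cases the index is the floor of half of [N.+1]. *)
have -> : (if odd N.+1 then (N.+1 - 1) %/ 2 else N.+1 %/ 2) = N.+1./2.
  by rewrite !divn2 subn1 /=; case: (boolP (odd N)) => oN //=; rewrite uphalf_half (negPf oN).
rewrite (peak_algebra_Fil N two); split.
- by case: N N0.
- exact: radical_expv0.
by move=> k k0; apply: contra_eqT; rewrite -ltnNge => kN; apply: radical_expv_neq0; rewrite ?k0.
Qed.
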